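(* Let $n\in\mathbb{N}$. Then $R_{\mathcal{S}^*_{Ne,n}}(\mathcal{W}_n)=\left(\dfrac{2}{3n+\sqrt{9n^2+4}}\right)^{1/n}$, and this radius is sharp, attained by $f(z)=z(1+z^n)/(1-z^n)$.
   Context: $\mathbb{D}=\{|z|<1\}$, $\mathbb{D}_r=\{|z|<r\}$. For $n\in\mathbb{N}$, $\mathcal{A}_n$ is the class of analytic functions on $\mathbb{D}$ of the form $f(z)=z+\sum_{k\ge n+1}a_kz^k$; for such $f$ let $\mathcal{Q}_f(z)=zf'(z)/f(z)$. $\mathcal{P}_n$ is the class of analytic $p(z)=1+\sum_{k\ge n}p_kz^k$ on $\mathbb{D}$ with $\mathrm{Re}\,p(z)>0$. $\mathcal{W}_n=\{f\in\mathcal{A}_n: f(z)/z\in\mathcal{P}_n\}$. Let $\varphi_{Ne}(z)=1+z-z^3/3$ (univalent on $\mathbb{D}$), $\Omega_{Ne}=\varphi_{Ne}(\mathbb{D})$, $\mathcal{S}^*_{Ne}$ the set of $f$ ($f(0)=0,f'(0)=1$) with $\mathcal{Q}_f\prec\varphi_{Ne}$ (i.e. $\mathcal{Q}_f=\varphi_{Ne}\circ w$, $w:\mathbb{D}\to\mathbb{D}$ analytic, $w(0)=0$), $\mathcal{S}^*_{Ne,n}=\mathcal{S}^*_{Ne}\cap\mathcal{A}_n$. For $\mathcal{G}\subset\mathcal{A}_n$, $R_{\mathcal{S}^*_{Ne,n}}(\mathcal{G})$ is the largest $\rho\in(0,1]$ such that $\mathcal{Q}_f(\mathbb{D}_\rho)\subseteq\Omega_{Ne}$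 for all $f\in\mathcal{G}$. Sharpness means the stated $f$ lies in $\mathcal{W}_n$ and $\mathcal{Q}_f(\partial\mathbb{D}_\rho)\cap\partial\Omega_{Ne}\ne\emptyset$. *)

(* Defs.v *)
From Stdlib Require Import Reals Lra.
Open Scope R_scope.

Record C := mkC { Cre : R; Cim : R }.

Definition RtoC (x : R) : C := mkC x 0.
Definition C0 : C := RtoC 0.
Definition C1 : C := RtoC 1.
Definition Cadd (z w : C) : C := mkC (Cre z + Cre w) (Cim z + Cim w).
Definition Copp (z : C) : C := mkC (- Cre z) (- Cim z).
Definition Csub (z w : C) : C := Cadd z (Copp w).
Definition Cmul (z w : C) : C :=
  mkC (Cre z * Cre w - Cim z * Cim w) (Cre z * Cim w + Cim z * Cre w).
Definition Cnorm2 (z : C) : R := Cre z * Cre z + Cim z * Cim z.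
Definition Cnorm (z : C) : R := sqrt (Cnorm2 z).
Definition Cinv (z : C) : C := mkC (Cre z / Cnorm2 z) (- Cim z / Cnorm2 z).
Definition Cdiv (z w : C) : C := Cmul z (Cinv w).
Fixpoint Cpow (z : C) (k : nat) : C :=
  match k with O => C1 | S k' => Cmul z (Cpow z k') end.

Lemma Ceq_dec (z w : C) : {z = w} + {z <> w}.
Proof.
  destruct z as [a b], w as [c d].
  destruct (Req_EM_T a c) as [H1|H1]; destruct (Req_EM_T b d) as [H2|H2].
  - left; subst; reflexivity.
  - right; intro H; inversion H; contradiction.
  - right; intro H; inversion H; contradiction.
  - right; intro H; inversion H; contradiction.
Defined.

Fixpoint Cpartial (u : nat -> C) (m : nat) : C :=
  match m with O => u O | S m' => Cadd (Cpartial u m') (u m) end.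

Definition Cseries_conv (u : nat -> C) (l : C) : Prop :=
  forall eps, 0 < eps -> exists N : nat, forall m, (N <= m)%nat ->
    Cnorm (Csub (Cpartial u m) l) < eps.

Definition C_deriv (f : C -> C) (z d : C) : Prop :=
  forall eps, 0 < eps -> exists delta, 0 < delta /\
    forall h, h <> C0 -> Cnorm h < delta ->
      Cnorm (Csub (Cdiv (Csub (f (Cadd z h)) (f z)) h) d) < eps.

Definition in_disk (r : R) (z : C) : Prop := Cnorm z < r.
Definition in_D (z : C) : Prop := in_disk 1 z.

(** f in A_n : f(z) = z + sum_{k>=n+1} a_k z^k on D (analytic on D, given by
    its Taylor series at 0 which converges on D). *)
Definition class_A (n : nat) (f : C -> C) : Prop :=
  exists a : nat -> C,
    a O = C0 /\ a 1%nat = C1 /\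
    (forall k, (2 <= k <= n)%nat -> a k = C0) /\
    (forall z, in_D z -> Cseries_conv (fun k => Cmul (a k) (Cpow z k)) (f z)).

Definition class_P (n : nat) (p : C -> C) : Prop :=
  (exists c : nat -> C,
    c O = C1 /\
    (forall k, (1 <= k < n)%nat -> c k = C0) /\
    (forall z, in_D z -> Cseries_conv (fun k => Cmul (c k) (Cpow z k)) (p z))) /\
  (forall z, in_D z -> 0 < Cre (p z)).

(** f(z)/z, with its removable singularity at 0 filled by f'(0) = 1 *)
Definition f_over_z (f : C -> C) (z : C) : C :=
  if Ceq_dec z C0 then C1 else Cdiv (f z) z.

Definition class_W (n : nat) (f : C -> C) : Prop :=
  class_A n f /\ class_P n (f_over_z f).

Definition phi_Ne (u : C) : C :=
  Csub (Cadd C1 u) (Cdiv (Cpow u 3) (RtoC 3)).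

Definition Omega_Ne (w : C) : Prop := exists u, in_D u /\ w = phi_Ne u.

Definition bd_Omega_Ne (w : C) : Prop :=
  forall eps, 0 < eps ->
    (exists w1, Omega_Ne w1 /\ Cnorm (Csub w1 w) < eps) /\
    (exists w2, ~ Omega_Ne w2 /\ Cnorm (Csub w2 w) < eps).

Definition Q_value (f : C -> C) (z q : C) : Prop :=
  f z <> C0 /\ exists d, C_deriv f z d /\ q = Cdiv (Cmul z d) (f z).

(** Q_f(D_rho) is contained in Omega_Ne.  At z = 0, Q_f(0) = 1 = phi_Ne 0
    lies in Omega_Ne automatically, so only z <> 0 is required. *)
Definition Q_maps_into_Ne (f : C -> C) (rho : R) : Prop :=
  forall z, in_disk rho z -> z <> C0 ->
    exists q, Q_value f z q /\ Omega_Ne q.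

Definition admissible_radius (G : (C -> C) -> Prop) (rho : R) : Prop :=
  0 < rho <= 1 /\ forall f, G f -> Q_maps_into_Ne f rho.

Definition is_radius_Ne (G : (C -> C) -> Prop) (r : R) : Prop :=
  admissible_radius G r /\ forall rho, admissible_radius G rho -> rho <= r.

Definition f_extremal (n : nat) (z : C) : C :=
  Cdiv (Cmul z (Cadd C1 (Cpow z n))) (Csub C1 (Cpow z n)).

(* Main.v *)
From Stdlib Require Import Reals Lra Lia Psatz ZArith.
From Coquelicot Require Import Rcomplements Rbar Hierarchy Lim_seq Series.
Require Import Defs.
Open Scope R_scope.

(** Write [p = f/z = sum c_k z^k] and [D = z p'], so that [Q_f = 1 + D/p].  The
    disk of radius 2/3 about 1 lies in [Omega_Ne] and touches its boundary at
    5/3, so the point is the estimate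
    [(1 - s^2) |D| <= 2 n s Re p] at [|z| = r], where [s = r^n]: at the radius
    of the theorem [s^2 + 3 n s = 1], i.e. [2 n s / (1 - s^2) = 2/3].

    Only power series are used.  If [Re e] and [Re b] are nonnegative on the
    unit circle, averaging [Re e(w) Re b(conj w)] over roots of unity [w] gives
    [0 <= Re (sum e_k b_k + conj e_0 b_0)].  For a unimodular [eta] the function
    [q = 2 p - eta z^n (p + 1) - conj eta z^-n (p - 1)] has real part
    [|1 - eta z^n|^2 Re p] on the circle.  Pairing it with the kernel
    [b_k = (A + B k) r^k], [A = 1 + s^2], [B = (1 - s^2)/n] (halved at [k = 0])
    gives [(B/s) Re (conj eta (1 - eta s)^2 D) <= 2 |1 - eta s|^2 Re p], and
    [eta] is chosen to make the left side equal to [(B/s) |1 - eta s|^2 |D|]. *)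

(* Averaged positivity only gives inequalities that are linear in [p(z)] and [D], while a bound on
   [|D|] is wanted; hence a family of inequalities indexed by [eta], from which one member is picked
   for each direction of [D].

   The shape of [q] is dictated by two demands. On the circle [|1 - eta z^n|^2 p = 2 p - eta z^n p -
   conj eta z^-n p] has the right real part but contains the power [z^-n]. Adding
   [conj eta z^-n - eta z^n], which is purely imaginary there, removes it: the coefficients of [p]
   of index 1 to [n - 1] vanish, so [z^-n (p - 1)] is again a power series. This is where the gap of
   the class enters the estimate.

   Positivity is needed on the closed unit circle, while [p] is only given inside the disk. The
   point [z] is therefore written as [y r] with [|y| < 1], and the argument is applied to [p(y w)]
   at the real point [w = r]. *)
Declare Scope cx_scope.
Delimit Scope cx_scope with cx.
Bind Scope cx_scope with C.
Infix "+" := Cadd : cx_scope.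
Infix "-" := Csub : cx_scope.
Infix "*" := Cmul : cx_scope.
Infix "/" := Cdiv : cx_scope.
Infix "^" := Cpow : cx_scope.
Notation "- z" := (Copp z) : cx_scope.
Arguments Cadd _%_cx _%_cx.
Arguments Csub _%_cx _%_cx.
Arguments Cmul _%_cx _%_cx.
Arguments Cdiv _%_cx _%_cx.
Arguments Copp _%_cx.
Arguments Cinv _%_cx.
Arguments Cpow _%_cx _%_nat.
Arguments Cnorm _%_cx.
Arguments Cnorm2 _%_cx.
Arguments Cre _%_cx.
Arguments Cim _%_cx.
Arguments RtoC _%_R.

(** * Complex arithmetic, the modulus and the unit circle *)

Definition Cconj (z : C) : C := mkC (Cre z) (- Cim z).
Definition cis (t : R) : C := mkC (cos t) (sin t).

Lemma C_ext (z w : C) : Cre z = Cre w -> Cim z = Cim w -> z = w.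
Proof. destruct z, w; simpl; intros; subst; reflexivity. Qed.

Ltac cx_eq := intros; apply C_ext; simpl; try ring.

Lemma C_ring_theory : ring_theory C0 C1 Cadd Cmul Csub Copp eq.
Proof. constructor; cx_eq. Qed.

Lemma Cnorm2_ge0 (z : C) : 0 <= Cnorm2 z.
Proof. unfold Cnorm2; nra. Qed.

Lemma Cnorm2_neq0 (z : C) : z <> C0 -> Cnorm2 z <> 0.
Proof.
  intros H E; apply H; unfold Cnorm2 in E; apply C_ext; simpl; nra.
Qed.

Lemma C_field_theory : field_theory C0 C1 Cadd Cmul Csub Copp Cdiv Cinv eq.
Proof.
  constructor.
  - exact C_ring_theory.
  - intro H; injection H; lra.
  - reflexivity.
  - intros z Hz; pose proof (Cnorm2_neq0 z Hz) as H.
    unfold Cnorm2 in H; apply C_ext; simpl; unfold Cnorm2; field; exact H.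
Qed.

Add Field C_field : C_field_theory.

Lemma Cnorm2_mul (z w : C) : Cnorm2 (z * w) = Cnorm2 z * Cnorm2 w.
Proof. unfold Cnorm2; simpl; ring. Qed.

Lemma Cnorm_ge0 (z : C) : 0 <= Cnorm z.
Proof. apply sqrt_pos. Qed.

Lemma Cnorm_sqr (z : C) : Cnorm z * Cnorm z = Cnorm2 z.
Proof. apply sqrt_sqrt, Cnorm2_ge0. Qed.

Lemma Cnorm_mul (z w : C) : Cnorm (z * w) = Cnorm z * Cnorm w.
Proof.
  unfold Cnorm; rewrite Cnorm2_mul; apply sqrt_mult; apply Cnorm2_ge0.
Qed.

Lemma Cnorm_RtoC (x : R) : Cnorm (RtoC x) = Rabs x.
Proof.
  unfold Cnorm, Cnorm2; simpl.
  replace (x * x + 0 * 0) with (Rsqr x) by (unfold Rsqr; ring).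
  apply sqrt_Rsqr_abs.
Qed.

Lemma Cnorm_C0 : Cnorm C0 = 0.
Proof. unfold C0; rewrite Cnorm_RtoC; apply Rabs_R0. Qed.

Lemma Cnorm_C1 : Cnorm C1 = 1.
Proof. unfold C1; rewrite Cnorm_RtoC; apply Rabs_R1. Qed.

Lemma Cnorm_opp (z : C) : Cnorm (- z) = Cnorm z.
Proof. unfold Cnorm, Cnorm2; simpl; f_equal; ring. Qed.

Lemma Cnorm_conj (z : C) : Cnorm (Cconj z) = Cnorm z.
Proof. unfold Cnorm, Cnorm2; simpl; f_equal; ring. Qed.

Lemma Cnorm_pow (z : C) (k : nat) : Cnorm (z ^ k) = Cnorm z ^ k.
Proof.
  induction k as [|k IH]; simpl; [apply Cnorm_C1|].
  rewrite Cnorm_mul, IH; reflexivity.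
Qed.

Lemma Cnorm_pos (z : C) : z <> C0 -> 0 < Cnorm z.
Proof.
  intro H; apply sqrt_lt_R0; pose proof (Cnorm2_ge0 z);
  pose proof (Cnorm2_neq0 z H); lra.
Qed.

Lemma Cnorm_neq0 (z : C) : 0 < Cnorm z -> z <> C0.
Proof. intros H ->; rewrite Cnorm_C0 in H; lra. Qed.

Lemma Rabs_Cre_le (z : C) : Rabs (Cre z) <= Cnorm z.
Proof.
  rewrite <- (sqrt_Rsqr_abs (Cre z)); apply sqrt_le_1_alt.
  unfold Rsqr, Cnorm2; nra.
Qed.

Lemma Rabs_Cim_le (z : C) : Rabs (Cim z) <= Cnorm z.
Proof.
  rewrite <- (sqrt_Rsqr_abs (Cim z)); apply sqrt_le_1_alt.
  unfold Rsqr, Cnorm2; nra.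
Qed.

Lemma Cre_le_Cnorm (z : C) : Cre z <= Cnorm z.
Proof. pose proof (Rabs_Cre_le z); pose proof (Rle_abs (Cre z)); lra. Qed.

Lemma Cnorm_le_parts (z : C) : Cnorm z <= Rabs (Cre z) + Rabs (Cim z).
Proof.
  pose proof (Rabs_pos (Cre z)); pose proof (Rabs_pos (Cim z)).
  apply Rsqr_incr_0_var; [|lra].
  unfold Rsqr; rewrite Cnorm_sqr; unfold Cnorm2.
  assert (E : forall x, x * x = Rabs x * Rabs x)
    by (intro x; rewrite <- Rabs_mult; symmetry; apply Rabs_pos_eq; nra).
  rewrite (E (Cre z)), (E (Cim z)); nra.
Qed.

Lemma Cnorm_triangle (z w : C) : Cnorm (z + w) <= Cnorm z + Cnorm w.
Proof.
  pose proof (Cnorm_ge0 z); pose proof (Cnorm_ge0 w).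
  apply Rsqr_incr_0_var; [|lra].
  unfold Rsqr; rewrite Cnorm_sqr.
  pose proof (Cnorm_sqr z) as Hz; pose proof (Cnorm_sqr w) as Hw.
  pose proof (Cre_le_Cnorm (z * Cconj w)) as H1.
  rewrite Cnorm_mul, Cnorm_conj in H1; simpl in H1.
  assert (E : Cnorm2 (z + w) = Cnorm2 z + Cnorm2 w
              + 2 * (Cre z * Cre w + Cim z * Cim w))
    by (unfold Cnorm2; simpl; ring).
  rewrite E; nra.
Qed.

Lemma Cnorm_sub_sym (z w : C) : Cnorm (z - w) = Cnorm (w - z).
Proof. rewrite <- Cnorm_opp; f_equal; ring. Qed.

Lemma Cnorm_inv (z : C) : z <> C0 -> Cnorm (Cinv z) = / Cnorm z.
Proof.
  intro H; pose proof (Cnorm_pos z H).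
  apply Rmult_eq_reg_l with (Cnorm z); [|lra].
  rewrite <- Cnorm_mul, Rinv_r by lra.
  replace (z * Cinv z)%cx with C1 by (field; exact H).
  apply Cnorm_C1.
Qed.

Lemma Cnorm_div (z w : C) : w <> C0 -> Cnorm (z / w) = Cnorm z / Cnorm w.
Proof.
  intro H; unfold Cdiv; rewrite Cnorm_mul, Cnorm_inv by exact H; reflexivity.
Qed.

Lemma Cmul_neq0 (z w : C) : z <> C0 -> w <> C0 -> (z * w)%cx <> C0.
Proof.
  intros Hz Hw; apply Cnorm_neq0; rewrite Cnorm_mul.
  apply Rmult_lt_0_compat; apply Cnorm_pos; assumption.
Qed.

Lemma Cmul_conj (z : C) : (z * Cconj z)%cx = RtoC (Cnorm2 z).
Proof. cx_eq; unfold Cnorm2; ring. Qed.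

Lemma Cpow_mul (z w : C) (k : nat) : ((z * w) ^ k = z ^ k * w ^ k)%cx.
Proof. induction k as [|k IH]; simpl; [ring|rewrite IH; ring]. Qed.

Lemma Cpow_add (z : C) (j k : nat) : (z ^ (j + k) = z ^ j * z ^ k)%cx.
Proof. induction j as [|j IH]; simpl; [ring|rewrite IH; ring]. Qed.

Lemma Cpow_RtoC (x : R) (k : nat) : (RtoC x ^ k)%cx = RtoC (x ^ k).
Proof. induction k as [|k IH]; simpl; [reflexivity|rewrite IH; cx_eq]. Qed.

Lemma RtoC_mul (x y : R) : RtoC (x * y) = (RtoC x * RtoC y)%cx.
Proof. cx_eq. Qed.

Lemma RtoC_add (x y : R) : RtoC (x + y) = (RtoC x + RtoC y)%cx.
Proof. cx_eq. Qed.

Lemma RtoC_neq0 (x : R) : x <> 0 -> RtoC x <> C0.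
Proof. intros H E; injection E; exact H. Qed.

Lemma Cnorm_cis (t : R) : Cnorm (cis t) = 1.
Proof.
  unfold Cnorm, Cnorm2; simpl.
  replace (cos t * cos t + sin t * sin t) with 1
    by (pose proof (sin2_cos2 t) as H; unfold Rsqr in H; lra).
  apply sqrt_1.
Qed.

Lemma cis_add (s t : R) : cis (s + t) = (cis s * cis t)%cx.
Proof. cx_eq; [apply cos_plus|rewrite sin_plus; ring]. Qed.

Lemma cis_0 : cis 0 = C1.
Proof. cx_eq; [apply cos_0|apply sin_0]. Qed.

Lemma cis_pow (t : R) (k : nat) : (cis t ^ k)%cx = cis (INR k * t).
Proof.
  induction k as [|k IH].
  - simpl; rewrite Rmult_0_l, cis_0; reflexivity.
  - rewrite S_INR; simpl; rewrite IH, <- cis_add; f_equal; ring.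
Qed.

Lemma Cconj_cis (t : R) : Cconj (cis t) = cis (- t).
Proof. cx_eq; [symmetry; apply cos_neg|symmetry; apply sin_neg]. Qed.

Lemma Cconj_add (z w : C) : Cconj (z + w) = (Cconj z + Cconj w)%cx.
Proof. cx_eq. Qed.

Lemma Cconj_mul (z w : C) : Cconj (z * w) = (Cconj z * Cconj w)%cx.
Proof. cx_eq. Qed.

Lemma Cre_RtoC_mul (x : R) (z : C) : Cre (RtoC x * z) = x * Cre z.
Proof. simpl; ring. Qed.

(** * Finite sums and roots of unity *)

Lemma Cpartial_ext (u v : nat -> C) (m : nat) :
  (forall k, (k <= m)%nat -> u k = v k) -> Cpartial u m = Cpartial v m.
Proof.
  induction m as [|m IH]; intro H; simpl; [apply H; lia|].
  rewrite IH, (H (S m)) by (intros; try apply H; lia); reflexivity.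
Qed.

Lemma Cpartial_add (u v : nat -> C) (m : nat) :
  Cpartial (fun k => u k + v k)%cx m = (Cpartial u m + Cpartial v m)%cx.
Proof. induction m as [|m IH]; simpl; [|rewrite IH]; ring. Qed.

Lemma Cpartial_scal (a : C) (u : nat -> C) (m : nat) :
  Cpartial (fun k => a * u k)%cx m = (a * Cpartial u m)%cx.
Proof. induction m as [|m IH]; simpl; [|rewrite IH]; ring. Qed.

Lemma Cpartial_swap (u : nat -> nat -> C) (m p : nat) :
  Cpartial (fun j => Cpartial (u j) p) m
  = Cpartial (fun k => Cpartial (fun j => u j k) m) p.
Proof.
  induction m as [|m IH]; simpl; [reflexivity|].
  rewrite IH, <- Cpartial_add; reflexivity.
Qed.

Lemma Cpartial_mul (u v : nat -> C) (m p : nat) :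
  (Cpartial u m * Cpartial v p)%cx
  = Cpartial (fun k => Cpartial (fun l => u k * v l)%cx p) m.
Proof.
  induction m as [|m IH]; simpl; rewrite Cpartial_scal; [|rewrite <- IH]; ring.
Qed.

Lemma Cpartial_zero (u : nat -> C) (m : nat) :
  (forall k, (k <= m)%nat -> u k = C0) -> Cpartial u m = C0.
Proof.
  induction m as [|m IH]; intro H; simpl; [apply H; lia|].
  rewrite IH, (H (S m)) by (intros; try apply H; lia); ring.
Qed.

Lemma Cpartial_single (u : nat -> C) (m j : nat) :
  (j <= m)%nat -> (forall k, (k <= m)%nat -> k <> j -> u k = C0) ->
  Cpartial u m = u j.
Proof.
  induction m as [|m IH]; intros Hj H; simpl.
  - replace j with O by lia; reflexivity.
  - destruct (Nat.eq_dec j (S m)) as [->|Hne].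
    + rewrite Cpartial_zero; [ring|intros; apply H; lia].
    + rewrite IH, (H (S m)); try lia; [ring|intros; apply H; lia].
Qed.

Lemma Cpartial_conj (u : nat -> C) (m : nat) :
  Cconj (Cpartial u m) = Cpartial (fun k => Cconj (u k)) m.
Proof.
  induction m as [|m IH]; simpl; [reflexivity|rewrite Cconj_add, IH; reflexivity].
Qed.

Lemma Cpartial_geom (w : C) (m : nat) :
  ((w - C1) * Cpartial (fun j => w ^ j) m = w ^ S m - C1)%cx.
Proof.
  induction m as [|m IH]; [simpl; ring|].
  simpl Cpartial.
  replace ((w - C1) * (Cpartial (fun j => w ^ j) m + w * w ^ m))%cx
    with ((w - C1) * Cpartial (fun j => w ^ j) m + (w - C1) * (w * w ^ m))%cx
    by ring.
  rewrite IH; simpl; ring.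
Qed.

(** The argument of the [j]-th root of unity of order [S N']; with this order the inclusive sum
    [Cpartial _ N'] visits each root exactly once. *)
Definition root_angle (N' j : nat) : R := 2 * PI * INR j / INR (S N').

Lemma cis_2PI_Z (m : Z) : cis (2 * PI * IZR m) = C1.
Proof.
  assert (Hn : forall k : nat, cis (2 * PI * INR k) = C1).
  { intro k; induction k as [|k IH].
    - simpl; rewrite Rmult_0_r; apply cis_0.
    - rewrite S_INR, Rmult_plus_distr_l, cis_add, IH, Rmult_1_r.
      cx_eq; rewrite ?cos_2PI, ?sin_2PI; ring. }
  destruct (Z_le_gt_dec 0 m) as [H|H].
  - rewrite <- (Z2Nat.id m H), <- INR_IZR_INZ; apply Hn.
  - rewrite <- (Z.opp_involutive m), <- (Z2Nat.id (- m)) by lia.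
    rewrite opp_IZR, <- INR_IZR_INZ.
    replace (2 * PI * - INR (Z.to_nat (- m)))
      with (- (2 * PI * INR (Z.to_nat (- m)))) by ring.
    rewrite <- Cconj_cis, Hn; cx_eq.
Qed.

Lemma cis_neq1 (x : R) : 0 < x < 2 * PI -> cis x <> C1.
Proof.
  intros Hx E; injection E; intros _ Hc.
  assert (Hs : 0 < sin (x / 2)) by (apply sin_gt_0; lra).
  replace x with (2 * (x / 2)) in Hc by field.
  rewrite cos_2a_sin in Hc; nra.
Qed.

(** A geometric series whose ratio is a root of unity. The bound on [m] excludes the nonzero
    multiples of [S N'], for which the ratio would be 1. *)
Lemma sum_roots (N' : nat) (m : Z) : (Z.abs m <= Z.of_nat N')%Z ->
  Cpartial (fun j => cis (IZR m * root_angle N' j)) N'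
  = if Z.eq_dec m 0 then RtoC (INR (S N')) else C0.
Proof.
  intro Hm.
  assert (HN : 0 < INR (S N')) by (apply lt_0_INR; lia).
  destruct (Z.eq_dec m 0) as [->|Hne].
  - clear; generalize (root_angle N'); intro th.
    induction N' as [|N' IH].
    + simpl; rewrite Rmult_0_l, cis_0; reflexivity.
    + rewrite (S_INR (S N')), RtoC_add, <- IH; simpl Cpartial.
      rewrite Rmult_0_l, cis_0; reflexivity.
  - set (w := cis (IZR m * (2 * PI) / INR (S N'))).
    rewrite (Cpartial_ext _ (fun j => (w ^ j)%cx)).
    2:{ intros k _; unfold w; rewrite cis_pow; f_equal; unfold root_angle; field.
        lra. }
    assert (HwN : (w ^ S N')%cx = C1).
    { unfold w; rewrite cis_pow, <- (cis_2PI_Z m); f_equal; field; lra. }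
    assert (Hw : w <> C1).
    (* [cis_neq1] wants an angle strictly between 0 and 2 PI, so positive exponents come first and
       negative ones follow by conjugation. *)
    { assert (Hpos : forall q : Z, (0 < q <= Z.of_nat N')%Z ->
        cis (IZR q * (2 * PI) / INR (S N')) <> C1).
      { intros q Hq; apply cis_neq1.
        assert (0 < IZR q) by (apply IZR_lt; lia).
        assert (IZR q < INR (S N'))
          by (rewrite INR_IZR_INZ; apply IZR_lt; lia).
        pose proof PI_RGT_0.
        split.
        - apply Rdiv_lt_0_compat; nra.
        - apply Rmult_lt_reg_r with (INR (S N')); [lra|].
          unfold Rdiv; rewrite Rmult_assoc, Rinv_l by lra; nra. }
      destruct (Z_le_gt_dec 0 m) as [H|H]; [apply Hpos; lia|].
      intro E; apply (Hpos (- m)%Z); [lia|].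
      rewrite opp_IZR.
      replace (- IZR m * (2 * PI) / INR (S N'))
        with (- (IZR m * (2 * PI) / INR (S N'))) by (field; lra).
      rewrite <- Cconj_cis; fold w; rewrite E; cx_eq. }
    pose proof (Cpartial_geom w N') as G; rewrite HwN in G.
    replace (C1 - C1)%cx with C0 in G by ring.
    destruct (Ceq_dec (Cpartial (fun j => (w ^ j)%cx) N') C0) as [H|H]; [exact H|].
    exfalso; apply (Cmul_neq0 (w - C1) _) in H; [contradiction|].
    intro E; apply Hw; replace w with ((w - C1) + C1)%cx by ring; rewrite E; ring.
Qed.

(** Integer exponents cover both averages below: [w^k] against [conj w^l], and [conj w^k] against
    [conj w^l]. *)
Lemma sum_roots_mul (N' m p : nat) (e b : nat -> C) (al be : nat -> Z) :
  (forall k l, (k <= m)%nat -> (l <= p)%nat ->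
     (Z.abs (al k + be l) <= Z.of_nat N')%Z) ->
  Cpartial (fun j => Cpartial (fun k => e k * cis (IZR (al k) * root_angle N' j)) m
                   * Cpartial (fun l => b l * cis (IZR (be l) * root_angle N' j)) p)%cx N'
  = Cpartial (fun k => Cpartial (fun l =>
      e k * b l * (if Z.eq_dec (al k + be l) 0 then RtoC (INR (S N')) else C0))%cx p) m.
Proof.
  intro H.
  rewrite (Cpartial_ext _ (fun j => Cpartial (fun k => Cpartial (fun l =>
     e k * b l * cis (IZR (al k + be l) * root_angle N' j))%cx p) m)).
  2:{ intros j _; rewrite Cpartial_mul; apply Cpartial_ext; intros k _.
      apply Cpartial_ext; intros l _.
      rewrite plus_IZR, Rmult_plus_distr_r, cis_add; ring. }
  rewrite Cpartial_swap; apply Cpartial_ext; intros k Hk.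
  rewrite Cpartial_swap; apply Cpartial_ext; intros l Hl.
  rewrite Cpartial_scal, sum_roots by (apply H; assumption); reflexivity.
Qed.

Definition poly_at (e : nat -> C) (M : nat) (z : C) : C :=
  Cpartial (fun k => e k * z ^ k)%cx M.

Lemma poly_at_cis (e : nat -> C) (M : nat) (t : R) :
  poly_at e M (cis t) = Cpartial (fun k => e k * cis (IZR (Z.of_nat k) * t))%cx M.
Proof.
  apply Cpartial_ext; intros k _; rewrite cis_pow, INR_IZR_INZ; reflexivity.
Qed.

Lemma poly_at_cis_neg (e : nat -> C) (M : nat) (t : R) :
  poly_at e M (cis (- t)) = Cpartial (fun k => e k * cis (IZR (- Z.of_nat k) * t))%cx M.
Proof.
  apply Cpartial_ext; intros k _; rewrite cis_pow, INR_IZR_INZ, opp_IZR.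
  do 2 f_equal; ring.
Qed.

(** Only the diagonal [k = l] survives. The order [2 M + 1] is chosen so that the same nodes also
    serve [average_conj], whose exponents reach [- 2 M]. *)
Lemma average_Hadamard (e b : nat -> C) (M : nat) :
  Cpartial (fun j => poly_at e M (cis (root_angle (2 * M) j))
                   * poly_at b M (cis (- root_angle (2 * M) j)))%cx (2 * M)
  = (RtoC (INR (S (2 * M))) * Cpartial (fun k => e k * b k)%cx M)%cx.
Proof.
  rewrite (Cpartial_ext _ (fun j =>
    Cpartial (fun k => e k * cis (IZR (Z.of_nat k) * root_angle (2 * M) j)) M
    * Cpartial (fun l => b l * cis (IZR (- Z.of_nat l) * root_angle (2 * M) j)) M)%cx)
    by (intros j _; rewrite poly_at_cis, poly_at_cis_neg; reflexivity).
  rewrite (sum_roots_mul _ _ _ e b (fun k => Z.of_nat k) (fun l => (- Z.of_nat l)%Z))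
    by (intros; lia).
  rewrite <- Cpartial_scal; apply Cpartial_ext; intros k Hk.
  rewrite (Cpartial_single _ M k Hk).
  - destruct (Z.eq_dec _ 0); [ring|lia].
  - intros l Hl Hne; destruct (Z.eq_dec _ 0); [lia|ring].
Qed.

(** The exponents [- (k + l)] vanish only at [k = l = 0]. Added to [average_Hadamard], this replaces
    [e] by [e + conj e = 2 Re e]. *)
Lemma average_conj (e b : nat -> C) (M : nat) :
  Cpartial (fun j => Cconj (poly_at e M (cis (root_angle (2 * M) j)))
                   * poly_at b M (cis (- root_angle (2 * M) j)))%cx (2 * M)
  = (RtoC (INR (S (2 * M))) * (Cconj (e O) * b O))%cx.
Proof.
  rewrite (Cpartial_ext _ (fun j =>
    Cpartial (fun k => Cconj (e k) * cis (IZR (- Z.of_nat k) * root_angle (2 * M) j)) M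
    * Cpartial (fun l => b l * cis (IZR (- Z.of_nat l) * root_angle (2 * M) j)) M)%cx).
  2:{ intros j _; rewrite poly_at_cis, poly_at_cis_neg, Cpartial_conj.
      f_equal; apply Cpartial_ext; intros k _.
      rewrite Cconj_mul, Cconj_cis, opp_IZR; do 2 f_equal; ring. }
  rewrite (sum_roots_mul _ _ _ (fun k => Cconj (e k)) b
    (fun k => (- Z.of_nat k)%Z) (fun l => (- Z.of_nat l)%Z)) by (intros; lia).
  rewrite (Cpartial_single _ M O);
    [|lia|intros k _ Hne; apply Cpartial_zero; intros l _;
      destruct (Z.eq_dec _ 0); [lia|ring]].
  rewrite (Cpartial_single _ M O);
    [|lia|intros l _ Hne; destruct (Z.eq_dec _ 0); [lia|ring]].
  destruct (Z.eq_dec _ 0); [ring|lia].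
Qed.

(** * Complex series *)

Lemma Cre_Cpartial (u : nat -> C) (m : nat) :
  Cre (Cpartial u m) = sum_n (fun k => Cre (u k)) m.
Proof.
  induction m as [|m IH]; simpl; [rewrite sum_O|rewrite sum_Sn, IH]; reflexivity.
Qed.

Lemma Cim_Cpartial (u : nat -> C) (m : nat) :
  Cim (Cpartial u m) = sum_n (fun k => Cim (u k)) m.
Proof.
  induction m as [|m IH]; simpl; [rewrite sum_O|rewrite sum_Sn, IH]; reflexivity.
Qed.

Lemma is_series_eps (a : nat -> R) (l : R) :
  is_series a l <->
  forall eps, 0 < eps -> exists N, forall m, (N <= m)%nat -> Rabs (sum_n a m - l) < eps.
Proof.
  split; intro H.
  - intros eps He.
    assert (H' : is_lim_seq (sum_n a) l) by exact H.
    apply is_lim_seq_spec in H'.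
    exact (H' (mkposreal eps He)).
  - change (is_lim_seq (sum_n a) l); apply is_lim_seq_spec.
    intros [eps He]; exact (H eps He).
Qed.

Lemma Cseries_conv_parts (u : nat -> C) (l : C) :
  Cseries_conv u l <->
  is_series (fun k => Cre (u k)) (Cre l) /\ is_series (fun k => Cim (u k)) (Cim l).
Proof.
  rewrite !is_series_eps; split.
  - intro H; split; intros eps He; destruct (H eps He) as [N HN]; exists N;
      intros m Hm; specialize (HN m Hm).
    + rewrite <- Cre_Cpartial.
      pose proof (Rabs_Cre_le (Cpartial u m - l)) as G; simpl in G; unfold Rminus; lra.
    + rewrite <- Cim_Cpartial.
      pose proof (Rabs_Cim_le (Cpartial u m - l)) as G; simpl in G; unfold Rminus; lra.
  - intros [H1 H2] eps He.
    destruct (H1 (eps / 2)) as [N1 HN1]; [lra|].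
    destruct (H2 (eps / 2)) as [N2 HN2]; [lra|].
    exists (N1 + N2)%nat; intros m Hm.
    specialize (HN1 m ltac:(lia)); specialize (HN2 m ltac:(lia)).
    pose proof (Cnorm_le_parts (Cpartial u m - l)) as G; simpl in G.
    rewrite <- Cre_Cpartial in HN1; rewrite <- Cim_Cpartial in HN2.
    unfold Rminus in *; lra.
Qed.

Lemma Cseries_conv_unique (u : nat -> C) (l l' : C) :
  Cseries_conv u l -> Cseries_conv u l' -> l = l'.
Proof.
  rewrite !Cseries_conv_parts; intros [H1 H2] [H3 H4]; apply C_ext.
  - rewrite <- (is_series_unique _ _ H1); apply is_series_unique; exact H3.
  - rewrite <- (is_series_unique _ _ H2); apply is_series_unique; exact H4.
Qed.

Lemma Cseries_conv_ext (u v : nat -> C) (l : C) :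
  (forall k, u k = v k) -> Cseries_conv u l -> Cseries_conv v l.
Proof.
  intros E H eps He; destruct (H eps He) as [N HN]; exists N; intros m Hm.
  rewrite <- (Cpartial_ext u v) by auto; auto.
Qed.

Lemma Cseries_conv_add (u v : nat -> C) (l l' : C) :
  Cseries_conv u l -> Cseries_conv v l' ->
  Cseries_conv (fun k => u k + v k)%cx (l + l').
Proof.
  rewrite !Cseries_conv_parts; intros [H1 H2] [H3 H4]; split; simpl.
  - exact (is_series_plus _ _ _ _ H1 H3).
  - exact (is_series_plus _ _ _ _ H2 H4).
Qed.

Lemma Cseries_conv_scal (a : C) (u : nat -> C) (l : C) :
  Cseries_conv u l -> Cseries_conv (fun k => a * u k)%cx (a * l).
Proof.
  rewrite !Cseries_conv_parts; intros [H1 H2]; split; simpl.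
  - exact (is_series_minus _ _ _ _ (is_series_scal (Cre a) _ _ H1)
      (is_series_scal (Cim a) _ _ H2)).
  - exact (is_series_plus _ _ _ _ (is_series_scal (Cre a) _ _ H2)
      (is_series_scal (Cim a) _ _ H1)).
Qed.

(** Lets a limit written with the abstract [plus] be matched, up to conversion, against an identity
    between real numbers. *)
Lemma is_series_cast (a : nat -> R) (l l' : R) : is_series a l -> l' = l -> is_series a l'.
Proof. intros H ->; exact H. Qed.

Lemma Rplus_sub_cancel (x y : R) : x + - y + y = x.
Proof. ring. Qed.

Lemma Rplus_cancel_sub (x y : R) : x + y + - y = x.
Proof. ring. Qed.

Lemma Cseries_conv_incr (u : nat -> C) (l : C) (n : nat) : (1 <= n)%nat ->
  Cseries_conv u l ->
  Cseries_conv (fun k => u (n + k)%nat) (l - Cpartial u (pred n)).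
Proof.
  rewrite !Cseries_conv_parts; intros Hn [H1 H2]; split; simpl;
    [rewrite Cre_Cpartial|rewrite Cim_Cpartial].
  - apply (is_series_incr_n (fun k => Cre (u k))); [lia|].
    apply (is_series_cast _ _ _ H1); exact (Rplus_sub_cancel _ _).
  - apply (is_series_incr_n (fun k => Cim (u k))); [lia|].
    apply (is_series_cast _ _ _ H2); exact (Rplus_sub_cancel _ _).
Qed.

Lemma Cseries_conv_decr (u : nat -> C) (l : C) (n : nat) : (1 <= n)%nat ->
  Cseries_conv (fun k => u (n + k)%nat) l ->
  Cseries_conv u (l + Cpartial u (pred n)).
Proof.
  rewrite !Cseries_conv_parts; intros Hn [H1 H2]; split; simpl;
    [rewrite Cre_Cpartial|rewrite Cim_Cpartial].
  - apply (is_series_decr_n _ n); [lia|].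
    apply (is_series_cast _ _ _ H1); exact (Rplus_cancel_sub _ _).
  - apply (is_series_decr_n _ n); [lia|].
    apply (is_series_cast _ _ _ H2); exact (Rplus_cancel_sub _ _).
Qed.

Definition abs_summable (u : nat -> C) : Prop := ex_series (fun k => Cnorm (u k)).

Lemma abs_summable_le (u : nat -> C) (a : nat -> R) :
  (forall k, Cnorm (u k) <= a k) -> ex_series a -> abs_summable u.
Proof.
  intros H Ha; apply (ex_series_le (K := R_AbsRing) (V := R_CompleteNormedModule) _ a); [|exact Ha].
  intro k; unfold norm; simpl; unfold abs; simpl.
  rewrite Rabs_pos_eq by apply Cnorm_ge0; apply H.
Qed.

Lemma abs_summable_conv (u : nat -> C) :
  abs_summable u -> exists l, Cseries_conv u l.
Proof.
  intro H.
  assert (H1 : ex_series (fun k => Cre (u k)))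
    by (apply (ex_series_le (K := R_AbsRing) (V := R_CompleteNormedModule) _ _ (fun k => Rabs_Cre_le (u k)) H)).
  assert (H2 : ex_series (fun k => Cim (u k)))
    by (apply (ex_series_le (K := R_AbsRing) (V := R_CompleteNormedModule) _ _ (fun k => Rabs_Cim_le (u k)) H)).
  destruct H1 as [x Hx], H2 as [y Hy]; exists (mkC x y).
  apply Cseries_conv_parts; split; assumption.
Qed.

Lemma sum_n_le_Series (a : nat -> R) (m : nat) :
  (forall k, 0 <= a k) -> ex_series a -> sum_n a m <= Series a.
Proof.
  intros Ha He; apply is_lim_seq_incr_compare.
  - exact (Series_correct _ He).
  - intro k; rewrite sum_Sn; unfold plus; simpl; pose proof (Ha (S k)); lra.
Qed.

Lemma Cnorm_Cpartial_sub (u : nat -> C) (M m : nat) : (M <= m)%nat ->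
  Cnorm (Cpartial u m - Cpartial u M)
  <= sum_n (fun k => Cnorm (u k)) m - sum_n (fun k => Cnorm (u k)) M.
Proof.
  induction 1 as [|m Hm IH].
  - replace (Cpartial u M - Cpartial u M)%cx with C0 by ring.
    rewrite Cnorm_C0; lra.
  - rewrite sum_Sn; unfold plus; simpl.
    replace (Cpartial u m + u (S m) - Cpartial u M)%cx
      with ((Cpartial u m - Cpartial u M) + u (S m))%cx by ring.
    pose proof (Cnorm_triangle (Cpartial u m - Cpartial u M) (u (S m))); lra.
Qed.

Lemma Cseries_limit_le (u : nat -> C) (l w : C) (B : R) (M : nat) :
  Cseries_conv u l -> (forall m, (M <= m)%nat -> Cnorm (Cpartial u m - w) <= B) ->
  Cnorm (l - w) <= B.
Proof.
  intros H HB; apply Rnot_lt_le; intro Hlt.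
  destruct (H (Cnorm (l - w) - B)) as [N HN]; [lra|].
  specialize (HN (N + M)%nat ltac:(lia)); specialize (HB (N + M)%nat ltac:(lia)).
  rewrite Cnorm_sub_sym in HN.
  pose proof (Cnorm_triangle (l - Cpartial u (N + M)) (Cpartial u (N + M) - w)) as T.
  replace (l - Cpartial u (N + M) + (Cpartial u (N + M) - w))%cx with (l - w)%cx in T
    by ring.
  lra.
Qed.

Lemma Cseries_tail (u : nat -> C) (l : C) (M : nat) :
  abs_summable u -> Cseries_conv u l ->
  Cnorm (l - Cpartial u M)
  <= Series (fun k => Cnorm (u k)) - sum_n (fun k => Cnorm (u k)) M.
Proof.
  intros Ha H; apply (Cseries_limit_le u l _ _ M H); intros m Hm.
  pose proof (Cnorm_Cpartial_sub u M m Hm).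
  pose proof (sum_n_le_Series _ m (fun k => Cnorm_ge0 (u k)) Ha); lra.
Qed.

Lemma Cpartial_norm_le (u : nat -> C) (m : nat) :
  abs_summable u -> Cnorm (Cpartial u m) <= Series (fun k => Cnorm (u k)).
Proof.
  intro Ha.
  pose proof (sum_n_le_Series _ m (fun k => Cnorm_ge0 (u k)) Ha) as H.
  refine (Rle_trans _ _ _ _ H); clear.
  induction m as [|m IH]; [rewrite sum_O; simpl; lra|].
  rewrite sum_Sn; unfold plus; simpl.
  pose proof (Cnorm_triangle (Cpartial u m) (u (S m))); lra.
Qed.

Lemma Cseries_norm_le (u : nat -> C) (l : C) :
  abs_summable u -> Cseries_conv u l ->
  Cnorm l <= Series (fun k => Cnorm (u k)).
Proof.
  intros Ha H; replace l with (l - C0)%cx by ring.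
  apply (Cseries_limit_le u l _ _ O H); intros m _.
  replace (Cpartial u m - C0)%cx with (Cpartial u m) by ring.
  apply Cpartial_norm_le; exact Ha.
Qed.

Lemma Cseries_terms_bounded (u : nat -> C) (l : C) :
  Cseries_conv u l -> exists B, forall k, Cnorm (u k) <= B.
Proof.
  rewrite Cseries_conv_parts; intros [H1 H2].
  assert (E1 := ex_series_lim_0 _ (ex_intro _ _ H1)).
  assert (E2 := ex_series_lim_0 _ (ex_intro _ _ H2)).
  destruct (filterlim_bounded (K := R_AbsRing) (V := R_NormedModule) _ (ex_intro _ 0 E1))
    as [B1 HB1].
  destruct (filterlim_bounded (K := R_AbsRing) (V := R_NormedModule) _ (ex_intro _ 0 E2))
    as [B2 HB2].
  exists (B1 + B2); intro k.
  pose proof (Cnorm_le_parts (u k)); specialize (HB1 k); specialize (HB2 k).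
  unfold norm in HB1, HB2; simpl in HB1, HB2; unfold abs in HB1, HB2; simpl in HB1, HB2.
  lra.
Qed.

(** [(k + 1) t^k] is at most [1 + t + ... + t^k], a partial sum of the geometric series. *)
Lemma succ_mul_pow_le (t : R) (k : nat) : 0 <= t < 1 -> INR (S k) * t ^ k <= / (1 - t).
Proof.
  intro Ht.
  assert (E : INR (S k) * t ^ k * (1 - t) <= 1 - t ^ S k).
  { induction k as [|k IH]; [simpl; lra|].
    rewrite (S_INR (S k)); set (x := INR (S k)) in *; clearbody x.
    simpl pow in *.
    assert (0 <= t ^ k <= 1) by (split; [apply pow_le; lra|
      rewrite <- (pow1 k); apply pow_incr; lra]).
    set (y := t ^ k) in *; clearbody y.
    assert (t * (x * y * (1 - t)) <= t * (1 - t * y)) by (apply Rmult_le_compat_l; lra).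
    assert (0 <= (1 - t) * (1 - t * y)) by (apply Rmult_le_pos; nra).
    nra. }
  assert (0 <= t ^ S k) by (apply pow_le; lra).
  apply Rmult_le_reg_r with (1 - t); [lra|]; rewrite Rinv_l by lra; lra.
Qed.

(** Of the four factors [t^k], two absorb [INR (S k) ^ 2] by [succ_mul_pow_le], one meets [c k], and
    the last leaves a convergent geometric series. *)
Lemma summable_of_bounded (c : nat -> R) (B t : R) :
  0 <= t < 1 -> (forall k, 0 <= c k) -> (forall k, c k * t ^ k <= B) ->
  ex_series (fun k => INR (S k) ^ 2 * (c k * (t * t * t * t) ^ k)).
Proof.
  intros Ht Hc HB.
  apply (ex_series_le (K := R_AbsRing) (V := R_CompleteNormedModule) _
    (fun k => (/ (1 - t) * / (1 - t) * B) * t ^ k)).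
  - intro k; unfold norm; simpl; unfold abs; simpl.
    change (match k with O => 1 | S _ => INR k + 1 end) with (INR (S k)).
    pose proof (pos_INR (S k)) as Hp; pose proof (pow_le t k (proj1 Ht)) as Hq.
    pose proof (succ_mul_pow_le t k Ht) as H1; specialize (HB k); specialize (Hc k).
    rewrite !Rpow_mult_distr.
    set (x := INR (S k)) in *; set (y := t ^ k) in *; set (w := / (1 - t)) in *.
    replace (x * (x * 1) * (c k * (y * y * y * y)))
      with ((x * y) * (x * y) * (c k * y) * y) by ring.
    assert (0 <= x * y) by nra; assert (0 <= c k * y) by nra.
    assert ((x * y) * (x * y) <= w * w) by nra.
    rewrite Rabs_pos_eq by (apply Rmult_le_pos; [|exact Hq]; apply Rmult_le_pos; nra).
    apply Rmult_le_compat_r; [exact Hq|].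
    assert (0 <= (x * y) * (x * y)) by (apply Rle_0_sqr).
    apply Rmult_le_compat; assumption.
  - apply (ex_series_scal (K := R_AbsRing) (V := R_NormedModule)), ex_series_geom;
      rewrite Rabs_pos_eq; lra.
Qed.

Lemma fourth_root (rho : R) : 0 <= rho < 1 ->
  exists t, 0 <= t < 1 /\ t * t * t * t = rho.
Proof.
  intro H; exists (sqrt (sqrt rho)).
  assert (Ht0 : 0 <= sqrt (sqrt rho)) by apply sqrt_pos.
  assert (Et : sqrt (sqrt rho) * sqrt (sqrt rho) * sqrt (sqrt rho) * sqrt (sqrt rho) = rho).
  { rewrite sqrt_sqrt by apply sqrt_pos.
    rewrite Rmult_assoc, sqrt_sqrt, sqrt_sqrt by (apply sqrt_pos || lra); reflexivity. }
  split; [split; [exact Ht0|]|exact Et].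
  set (t := sqrt (sqrt rho)) in *; clearbody t.
  apply Rnot_le_lt; intro H1.
  assert (1 <= t * t) by nra; assert (1 <= t * t * t) by nra; nra.
Qed.

(** Abel's argument: the terms are bounded at the radius [t] with [t^4 = rho]. The weight
    [INR (S k) ^ 2] is the one the second-order Taylor remainder needs, and it dominates the weights
    1 and [k] needed elsewhere. *)
Lemma summable_of_conv_on_disk (c : nat -> C) (rho : R) :
  (forall z, in_D z -> exists l, Cseries_conv (fun k => c k * z ^ k)%cx l) ->
  0 <= rho < 1 -> ex_series (fun k => INR (S k) ^ 2 * (Cnorm (c k) * rho ^ k)).
Proof.
  intros H Hr.
  destruct (fourth_root rho Hr) as [t [Ht Et]].
  destruct (H (RtoC t)) as [l Hl].
  { unfold in_D, in_disk; rewrite Cnorm_RtoC, Rabs_pos_eq; lra. }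
  destruct (Cseries_terms_bounded _ _ Hl) as [B HB].
  rewrite <- Et; apply (summable_of_bounded _ B t); [lra|intro; apply Cnorm_ge0|].
  intro k; specialize (HB k).
  rewrite Cnorm_mul, Cnorm_pow, Cnorm_RtoC, Rabs_pos_eq in HB by lra; exact HB.
Qed.

(** * Positivity of Hadamard products *)

Lemma average_positivity (e b : nat -> C) (M : nat) (E H eps : R) :
  0 <= eps ->
  (forall t, - eps <= Cre (poly_at e M (cis t)) <= E) ->
  (forall t, - eps <= Cre (poly_at b M (cis t)) <= H) ->
  - (2 * eps * (E + H + eps))
  <= Cre (Cpartial (fun k => e k * b k)%cx M + Cconj (e O) * b O).
Proof.
  intros Heps He Hb.
  pose proof (average_Hadamard e b M) as A1; pose proof (average_conj e b M) as A2.
  set (N := INR (S (2 * M))) in *.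
  assert (HN : 0 < N) by (apply lt_0_INR; lia).
  set (X := (Cpartial (fun k => e k * b k)%cx M + Cconj (e O) * b O)%cx).
  (* Since [e + conj e = 2 Re e] is real, each averaged product has real part
     [2 Re e(w) Re b(conj w)]. *)
  assert (A3 : N * Cre X = Cre (Cpartial (fun j =>
      RtoC 2 * (RtoC (Cre (poly_at e M (cis (root_angle (2 * M) j))))
      * poly_at b M (cis (- root_angle (2 * M) j)))) (2 * M))%cx).
  { rewrite <- Cre_RtoC_mul; f_equal; unfold X.
    replace (RtoC N * (Cpartial (fun k => e k * b k) M + Cconj (e O) * b O))%cx
      with (RtoC N * Cpartial (fun k => e k * b k) M + RtoC N * (Cconj (e O) * b O))%cx
      by ring.
    rewrite <- A1, <- A2, <- Cpartial_add; apply Cpartial_ext; cx_eq. }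
  assert (A4 : forall m, - (2 * eps * (E + H + eps)) * INR (S m) <= Cre (Cpartial (fun j =>
      RtoC 2 * (RtoC (Cre (poly_at e M (cis (root_angle (2 * M) j))))
      * poly_at b M (cis (- root_angle (2 * M) j)))) m)%cx).
  { assert (P : forall j, - (2 * eps * (E + H + eps)) <= Cre
      (RtoC 2 * (RtoC (Cre (poly_at e M (cis (root_angle (2 * M) j))))
      * poly_at b M (cis (- root_angle (2 * M) j))))).
    { intro j; rewrite !Cre_RtoC_mul.
      specialize (He (root_angle (2 * M) j)); specialize (Hb (- root_angle (2 * M) j)).
      set (x := Cre (poly_at e _ _)) in *; set (y := Cre (poly_at b _ _)) in *.
      clearbody x y.
      (* The real parts are nonnegative only up to [eps]; expanding this product gives
         [x * y >= - eps * (E + H + eps)]. *)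
      assert (0 <= (x + eps) * (y + eps)) by (apply Rmult_le_pos; lra).
      assert (0 <= eps * (E - x)) by (apply Rmult_le_pos; lra).
      assert (0 <= eps * (H - y)) by (apply Rmult_le_pos; lra).
      lra. }
    induction m as [|m IH]; [simpl Cpartial; simpl INR; rewrite Rmult_1_r; apply P|].
    rewrite (S_INR (S m)).
    specialize (P (S m)).
    change (Cre (Cpartial ?u (S m))) with (Cre (Cpartial u m) + Cre (u (S m))); cbv beta; lra. }
  specialize (A4 (2 * M)%nat); rewrite <- A3 in A4; fold N in A4; nra.
Qed.

Lemma abs_summable_on_circle (e : nat -> C) (t : R) :
  abs_summable e -> abs_summable (fun k => e k * cis t ^ k)%cx.
Proof.
  intro H; apply (abs_summable_le _ (fun k => Cnorm (e k))); [|exact H].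
  intro k; rewrite Cnorm_mul, Cnorm_pow, Cnorm_cis, pow1; lra.
Qed.

(** The existence of the sum on the circle is left to [abs_summable]. *)
Definition positive_on_circle (e : nat -> C) : Prop :=
  forall z l, Cnorm z = 1 -> Cseries_conv (fun k => e k * z ^ k)%cx l -> 0 <= Cre l.

(** The tail of the absolute series bounds the truncation error uniformly on the circle, so a
    truncation is almost nonnegative there. *)
Lemma truncation_bounds (e : nat -> C) (M : nat) (t : R) :
  abs_summable e -> positive_on_circle e ->
  - (Series (fun k => Cnorm (e k)) - sum_n (fun k => Cnorm (e k)) M)
  <= Cre (poly_at e M (cis t)) <= Series (fun k => Cnorm (e k)).
Proof.
  intros Ha Hp.
  pose proof (abs_summable_on_circle e t Ha) as Hc.
  assert (E : forall k, Cnorm (e k * cis t ^ k) = Cnorm (e k))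
    by (intro k; rewrite Cnorm_mul, Cnorm_pow, Cnorm_cis, pow1; ring).
  destruct (abs_summable_conv _ Hc) as [l Hl].
  pose proof (Hp _ _ (Cnorm_cis t) Hl) as Hl0.
  pose proof (Cseries_tail _ _ M Hc Hl) as T.
  cbv beta in T; rewrite (Series_ext _ _ E), (sum_n_ext _ _ M E) in T.
  pose proof (Cpartial_norm_le _ M Hc) as T2;
    cbv beta in T2; rewrite (Series_ext _ _ E) in T2.
  fold (poly_at e M (cis t)) in T, T2.
  pose proof (Cre_le_Cnorm (poly_at e M (cis t))).
  pose proof (Cre_le_Cnorm (l - poly_at e M (cis t))) as G; simpl in G.
  lra.
Qed.

(** Truncating both series at a common [M] reduces this to [average_positivity]. *)
Lemma Hadamard_positivity (e b : nat -> C) (X : C) :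
  abs_summable e -> abs_summable b -> positive_on_circle e -> positive_on_circle b ->
  Cseries_conv (fun k => e k * b k)%cx X -> 0 <= Cre (X + Cconj (e O) * b O).
Proof.
  intros Ha Hb Pa Pb HX; apply Rnot_lt_le; intro Hneg.
  set (d := - Cre (X + Cconj (e O) * b O)) in *.
  assert (Hd : 0 < d) by (unfold d; lra).
  set (E := Series (fun k => Cnorm (e k))); set (H := Series (fun k => Cnorm (b k))).
  assert (HE : 0 <= E) by (apply (Rle_trans _ _ _ (Cnorm_ge0 _) (Cpartial_norm_le e O Ha))).
  assert (HH : 0 <= H) by (apply (Rle_trans _ _ _ (Cnorm_ge0 _) (Cpartial_norm_le b O Hb))).
  (* With this choice the averaging error [2 eps (E + H + eps)] is at most [d / 4]; together with
     the tail of [X], which is below [d / 2], it cannot make up for the deficit [d]. *)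
  set (eps := Rmin 1 (d / (8 * (E + H + 1)))).
  assert (He0 : 0 < eps).
  { apply Rmin_pos; [lra|apply Rdiv_lt_0_compat; lra]. }
  assert (He1 : eps <= 1) by apply Rmin_l.
  assert (He2 : eps * (E + H + 1) <= d / 8).
  { apply Rle_trans with (d / (8 * (E + H + 1)) * (E + H + 1)).
    - apply Rmult_le_compat_r; [lra|apply Rmin_r].
    - right; field; lra. }
  destruct (proj1 (is_series_eps _ _) (Series_correct _ Ha) eps He0) as [N1 HN1].
  destruct (proj1 (is_series_eps _ _) (Series_correct _ Hb) eps He0) as [N2 HN2].
  destruct (HX (d / 2)) as [N3 HN3]; [lra|].
  set (M := (N1 + N2 + N3)%nat).
  specialize (HN1 M ltac:(lia)); specialize (HN2 M ltac:(lia)); specialize (HN3 M ltac:(lia)).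
  apply Rabs_def2 in HN1; apply Rabs_def2 in HN2.
  fold E in HN1; fold H in HN2.
  assert (G : - (2 * eps * (E + H + eps))
    <= Cre (Cpartial (fun k => e k * b k)%cx M + Cconj (e O) * b O)).
  { apply average_positivity; [lra| |]; intro t.
    - pose proof (truncation_bounds e M t Ha Pa) as T; fold E in T; lra.
    - pose proof (truncation_bounds b M t Hb Pb) as T; fold H in T; lra. }
  pose proof (Cre_le_Cnorm (Cpartial (fun k => e k * b k)%cx M - X)) as T.
  change (Cre (?a + ?b)%cx) with (Cre a + Cre b) in G.
  change (Cre (?a - ?b)%cx) with (Cre a + - Cre b) in T.
  assert (d = - (Cre X + Cre (Cconj (e O) * b O))) by reflexivity.
  nra.
Qed.

(** * Summable sequences, shifts and geometric series *)

Lemma abs_summable_add (u v : nat -> C) :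
  abs_summable u -> abs_summable v -> abs_summable (fun k => u k + v k)%cx.
Proof.
  intros Hu Hv; apply (abs_summable_le _ (fun k => Cnorm (u k) + Cnorm (v k))).
  - intro k; apply Cnorm_triangle.
  - exact (ex_series_plus (K := R_AbsRing) (V := R_NormedModule) _ _ Hu Hv).
Qed.

Lemma abs_summable_scal (a : C) (u : nat -> C) :
  abs_summable u -> abs_summable (fun k => a * u k)%cx.
Proof.
  intros Hu; apply (abs_summable_le _ (fun k => Cnorm a * Cnorm (u k))).
  - intro k; rewrite Cnorm_mul; lra.
  - exact (ex_series_scal (K := R_AbsRing) (V := R_NormedModule) _ _ Hu).
Qed.

Lemma abs_summable_shift (u : nat -> C) (n : nat) :
  abs_summable u <-> abs_summable (fun k => u (n + k)%nat).
Proof. exact (ex_series_incr_n (fun k => Cnorm (u k)) n). Qed.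

Lemma abs_summable_ext (u v : nat -> C) :
  (forall k, u k = v k) -> abs_summable u -> abs_summable v.
Proof.
  intros E H; apply (ex_series_ext (fun k => Cnorm (u k))); [|exact H].
  intro k; rewrite E; reflexivity.
Qed.

Definition single (n : nat) (a : C) (k : nat) : C := if Nat.eqb k n then a else C0.

Lemma single_conv (n : nat) (a : C) : Cseries_conv (single n a) a.
Proof.
  intros eps He; exists n; intros m Hm; unfold single.
  rewrite (Cpartial_single _ m n Hm).
  - rewrite Nat.eqb_refl; replace (a - a)%cx with C0 by ring; rewrite Cnorm_C0; exact He.
  - intros k _ Hk; apply Nat.eqb_neq in Hk; rewrite Hk; reflexivity.
Qed.

Lemma single_summable (n : nat) (a : C) : abs_summable (single n a).
Proof.
  apply (abs_summable_shift _ (S n)), (ex_series_ext (fun _ => 0)).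
  - intro k; unfold single; rewrite (proj2 (Nat.eqb_neq _ _)) by lia.
    rewrite Cnorm_C0; reflexivity.
  - exists 0; apply is_series_eps; intros eps He; exists O; intros m _.
    rewrite sum_n_const, Rmult_0_r, Rminus_0_r, Rabs_R0; exact He.
Qed.

(** The coefficients of [z^n] times the power series with coefficients [u]. *)
Definition delay (n : nat) (u : nat -> C) (k : nat) : C :=
  if Nat.ltb k n then C0 else u (k - n)%nat.

Lemma delay_add (n k : nat) (u : nat -> C) : delay n u (n + k) = u k.
Proof.
  unfold delay; rewrite (proj2 (Nat.ltb_ge _ _)) by lia; f_equal; lia.
Qed.

Lemma delay_lt (n k : nat) (u : nat -> C) : (k < n)%nat -> delay n u k = C0.
Proof. intro H; unfold delay; rewrite (proj2 (Nat.ltb_lt _ _)) by lia; reflexivity. Qed.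

Lemma delay_summable (n : nat) (u : nat -> C) :
  abs_summable u -> abs_summable (delay n u).
Proof.
  intro H; apply (abs_summable_shift _ n).
  apply (abs_summable_ext u); [intro k; symmetry; apply delay_add|exact H].
Qed.

Lemma geometric_summable (rho : R) : 0 <= rho < 1 ->
  ex_series (fun k => INR (S k) ^ 2 * (1 * rho ^ k)).
Proof.
  intro H; destruct (fourth_root rho H) as [t [Ht <-]].
  apply (summable_of_bounded (fun _ => 1) 1 t Ht); [intro; lra|].
  intro k; rewrite Rmult_1_l, <- (pow1 k); apply pow_incr; lra.
Qed.

Lemma INR_S_sqr_ge (k : nat) : 1 <= INR (S k) ^ 2 /\ INR k <= INR (S k) ^ 2.
Proof. rewrite S_INR; pose proof (pos_INR k); split; nra. Qed.

Lemma pow_summable (x : C) : Cnorm x < 1 -> abs_summable (fun k => x ^ k)%cx.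
Proof.
  intro H; pose proof (Cnorm_ge0 x).
  apply (abs_summable_le _ _) with (2 := geometric_summable (Cnorm x) (conj H0 H)).
  intro k; rewrite Cnorm_pow; pose proof (pow_le _ k H0).
  pose proof (INR_S_sqr_ge k); nra.
Qed.

Lemma index_pow_summable (x : C) : Cnorm x < 1 ->
  abs_summable (fun k => RtoC (INR k) * x ^ k)%cx.
Proof.
  intro H; pose proof (Cnorm_ge0 x).
  apply (abs_summable_le _ _) with (2 := geometric_summable (Cnorm x) (conj H0 H)).
  intro k; rewrite Cnorm_mul, Cnorm_pow, Cnorm_RtoC, Rabs_pos_eq by apply pos_INR.
  pose proof (pow_le _ k H0); pose proof (INR_S_sqr_ge k); nra.
Qed.

Lemma one_sub_neq0 (x : C) : Cnorm x < 1 -> (C1 - x)%cx <> C0.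
Proof.
  intros H E; assert (x = C1) by (replace x with (C1 - (C1 - x))%cx by ring; rewrite E; ring).
  subst x; rewrite Cnorm_C1 in H; lra.
Qed.

(** Dropping the first [n] terms of [u] leaves [x] times the series plus that of [v], so
    [(1 - x) l = a + m]. The closed forms of the geometric series and of their index-weighted
    versions come from this identity. *)
Lemma Cseries_self_shift (n : nat) (u v : nat -> C) (x a l m : C) : (1 <= n)%nat ->
  (C1 - x)%cx <> C0 ->
  (forall k, u (n + k)%nat = (x * u k + v k)%cx) -> Cpartial u (pred n) = a ->
  Cseries_conv u l -> Cseries_conv v m -> l = ((a + m) / (C1 - x))%cx.
Proof.
  intros Hn Hx E Ha Hu Hv.
  pose proof (Cseries_conv_incr u l n Hn Hu) as H1.
  pose proof (Cseries_conv_add _ _ _ _ (Cseries_conv_scal x _ _ Hu) Hv) as H2.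
  apply (Cseries_conv_ext _ _ _ E) in H1.
  pose proof (Cseries_conv_unique _ _ _ H1 H2) as H3; rewrite Ha in H3.
  replace (a + m)%cx with ((C1 - x) * l)%cx; [field; exact Hx|].
  replace ((C1 - x) * l)%cx with (l - a - x * l + a)%cx by ring; rewrite H3; ring.
Qed.

Lemma zero_series : Cseries_conv (fun _ => C0) C0.
Proof.
  intros eps He; exists O; intros m _; rewrite Cpartial_zero by reflexivity.
  replace (C0 - C0)%cx with C0 by ring; rewrite Cnorm_C0; exact He.
Qed.

Lemma geometric_conv (x : C) : Cnorm x < 1 ->
  Cseries_conv (fun k => x ^ k)%cx (C1 / (C1 - x)).
Proof.
  intro H; destruct (abs_summable_conv _ (pow_summable x H)) as [l Hl].
  pose proof (one_sub_neq0 x H) as Hx.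
  rewrite (Cseries_self_shift 1 (fun k => x ^ k)%cx (fun _ => C0) x C1 l C0 (le_n 1) Hx)
    in Hl; try assumption; try apply zero_series; try reflexivity.
  - replace (C1 / (C1 - x))%cx with ((C1 + C0) / (C1 - x))%cx; [exact Hl|field; exact Hx].
  - intro k; simpl; ring.
Qed.

Lemma index_geometric_conv (x : C) : Cnorm x < 1 ->
  Cseries_conv (fun k => RtoC (INR k) * x ^ k)%cx (x / ((C1 - x) * (C1 - x))).
Proof.
  intro H; destruct (abs_summable_conv _ (index_pow_summable x H)) as [l Hl].
  pose proof (one_sub_neq0 x H) as Hx.
  rewrite (Cseries_self_shift 1 (fun k => RtoC (INR k) * x ^ k)%cx (fun k => x * x ^ k)%cx
    x C0 l (x * (C1 / (C1 - x)))%cx (le_n 1) Hx) in Hl; try assumption.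
  - replace (x / ((C1 - x) * (C1 - x)))%cx
      with ((C0 + x * (C1 / (C1 - x))) / (C1 - x))%cx; [exact Hl|field; exact Hx].
  - intro k; change (1 + k)%nat with (S k); rewrite S_INR, RtoC_add; simpl Cpow.
    change (RtoC 1) with C1; ring.
  - simpl; cx_eq.
  - apply Cseries_conv_scal, geometric_conv; exact H.
Qed.

(** * The derivative estimate for functions with positive real part *)

Definition kernel (A B r : R) (k : nat) : C := RtoC ((A + B * INR k) * r ^ k).
(** The constant coefficient is halved because [Hadamard_positivity] counts it twice, through
    [e_0 b_0] and [conj e_0 b_0]. With [x = r z] the sum is [A (1 / (1 - x) - 1 / 2) + B x / (1 -
    x)^2], a multiple of the Poisson kernel (in real part) plus a multiple of the Koebe function. *)
Definition half_kernel (A B r : R) (k : nat) : C :=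
  (kernel A B r k + single 0 (RtoC (- (A / 2))) k)%cx.

Lemma half_kernel_summable (A B r : R) : 0 < r < 1 -> abs_summable (half_kernel A B r).
Proof.
  intro Hr; apply abs_summable_add; [|apply single_summable].
  assert (H : Cnorm (RtoC r) < 1) by (rewrite Cnorm_RtoC, Rabs_pos_eq; lra).
  apply (abs_summable_ext (fun k => RtoC A * RtoC r ^ k
    + RtoC B * (RtoC (INR k) * RtoC r ^ k))%cx).
  - intro k; rewrite Cpow_RtoC; unfold kernel; cx_eq.
  - apply abs_summable_add; apply abs_summable_scal;
      [apply pow_summable|apply index_pow_summable]; exact H.
Qed.

(** For [|x| = r] the Poisson part is [A (1 - r^2) / (2 |1 - x|^2)], and the Koebe part is at least
    [- B r / |1 - x|^2]. The common denominator reduces positivity to the stated condition on [A]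
    and [B]. *)
Lemma half_kernel_positive (A B r : R) : 0 < r < 1 -> 0 <= B ->
  2 * r * B <= A * (1 - r * r) -> positive_on_circle (half_kernel A B r).
Proof.
  intros Hr HB HAB z l Hz Hl.
  set (x := (RtoC r * z)%cx).
  assert (Hx : Cnorm x = r) by (unfold x; rewrite Cnorm_mul, Cnorm_RtoC, Hz, Rabs_pos_eq; lra).
  assert (Hx1 : Cnorm x < 1) by lra.
  assert (Hl' : l = (RtoC A * (C1 / (C1 - x)) + RtoC B * (x / ((C1 - x) * (C1 - x)))
                     + RtoC (- (A / 2)))%cx).
  { apply (Cseries_conv_unique _ _ _ Hl).
    apply (Cseries_conv_ext (fun k => RtoC A * x ^ k
      + RtoC B * (RtoC (INR k) * x ^ k) + single 0 (RtoC (- (A / 2))) k)%cx).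
    - intro k; unfold half_kernel, kernel, x; rewrite Cpow_mul, Cpow_RtoC.
      rewrite RtoC_mul, RtoC_add, RtoC_mul.
      destruct k as [|k]; [simpl; change (RtoC 1) with C1; ring|].
      change (single 0 (RtoC (- (A / 2))) (S k)) with C0; ring.
    - apply Cseries_conv_add; [|apply single_conv].
      apply Cseries_conv_add; apply Cseries_conv_scal;
        [apply geometric_conv|apply index_geometric_conv]; exact Hx1. }
  pose proof (one_sub_neq0 x Hx1) as Hd.
  set (N := Cnorm2 (C1 - x)).
  assert (HN : 0 < N) by (pose proof (Cnorm2_ge0 (C1 - x)); pose proof (Cnorm2_neq0 _ Hd);
    unfold N in *; lra).
  assert (E1 : Cre (C1 / (C1 - x)) = (1 + N - r * r) / (2 * N)).
  { rewrite <- Hx, Cnorm_sqr; unfold N in *; simpl; unfold Cnorm2 in *; simpl in *.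
    field; lra. }
  assert (E2 : - (r / N) <= Cre (x / ((C1 - x) * (C1 - x)))).
  { pose proof (Rabs_Cre_le (x / ((C1 - x) * (C1 - x)))) as G.
    rewrite Cnorm_div, Cnorm_mul, Cnorm_sqr, Hx in G by (apply Cmul_neq0; exact Hd).
    fold N in G; apply Rabs_le_between in G; lra. }
  assert (E : Cre l = A * Cre (C1 / (C1 - x)) + B * Cre (x / ((C1 - x) * (C1 - x))) - A / 2).
  { rewrite Hl'; generalize (C1 / (C1 - x))%cx (x / ((C1 - x) * (C1 - x)))%cx.
    intros u v; simpl; ring. }
  rewrite E, E1.
  apply Rle_trans with ((A * (1 - r * r) - 2 * r * B) / (2 * N)).
  - apply Rdiv_le_0_compat; lra.
  - apply Rle_trans with (A * ((1 + N - r * r) / (2 * N)) + B * (- (r / N)) - A / 2).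
    + right; field; lra.
    + apply (Rmult_le_compat_l B) in E2; [lra|exact HB].
Qed.

(* Coefficients of [2 p - eta z^n (p + 1) - conj eta z^-n (p - 1)], where [p = sum c_k z^k]. *)
Definition twist (n : nat) (eta : C) (c : nat -> C) (k : nat) : C :=
  (RtoC 2 * c k + (- eta) * (delay n c k + single n C1 k)
   + (- Cconj eta) * c (n + k)%nat)%cx.

Lemma twist_summable (n : nat) (eta : C) (c : nat -> C) :
  abs_summable c -> abs_summable (twist n eta c).
Proof.
  intro H; unfold twist.
  apply abs_summable_add; [apply abs_summable_add|]; apply abs_summable_scal.
  - exact H.
  - apply abs_summable_add; [apply delay_summable; exact H|apply single_summable].
  - apply (abs_summable_shift c n); exact H.
Qed.

(** The test sequence [x] is arbitrary because it is used twice: with the powers [z^k] to evaluate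
    the twist on the circle, and with [kernel] to pair it. *)
Lemma twist_conv (n : nat) (eta : C) (c x : nat -> C) (L0 L1 L2 : C) : (1 <= n)%nat ->
  Cseries_conv (fun k => c k * x k)%cx L0 ->
  Cseries_conv (fun k => c k * x (n + k)%nat)%cx L1 ->
  Cseries_conv (fun k => c (n + k)%nat * x k)%cx L2 ->
  Cseries_conv (fun k => twist n eta c k * x k)%cx
    (RtoC 2 * L0 - eta * (L1 + x n) - Cconj eta * L2).
Proof.
  intros Hn H0 H1 H2.
  assert (H3 : Cseries_conv (fun k => delay n c k * x k)%cx L1).
  { replace L1 with (L1 + Cpartial (fun k => delay n c k * x k)%cx (pred n))%cx.
    - apply (Cseries_conv_decr _ _ n Hn).
      apply (Cseries_conv_ext _ _ _ (fun k => f_equal (fun w => (w * x (n + k)%nat)%cx)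
        (eq_sym (delay_add n k c))) H1).
    - rewrite Cpartial_zero; [ring|].
      intros k Hk; rewrite delay_lt by lia; ring. }
  apply (Cseries_conv_ext (fun k => RtoC 2 * (c k * x k)
    + (- eta) * (delay n c k * x k + single n (x n) k)
    + (- Cconj eta) * (c (n + k)%nat * x k))%cx).
  - intro k; unfold twist, single; destruct (Nat.eqb_spec k n) as [->|_]; ring.
  - replace (RtoC 2 * L0 - eta * (L1 + x n) - Cconj eta * L2)%cx
      with (RtoC 2 * L0 + (- eta) * (L1 + x n) + (- Cconj eta) * L2)%cx by ring.
    repeat apply Cseries_conv_add; apply Cseries_conv_scal; try assumption.
    apply Cseries_conv_add; [assumption|apply single_conv].
Qed.

Lemma unit_conj_mul (z : C) : Cnorm z = 1 -> (z * Cconj z)%cx = C1.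
Proof. intro H; rewrite Cmul_conj, <- Cnorm_sqr, H; cx_eq. Qed.

(** Because of the gap, a shift by [n] loses nothing but the constant term. *)
Lemma Cpartial_gap (n : nat) (c x : nat -> C) : (1 <= n)%nat ->
  c O = C1 -> (forall k, (1 <= k < n)%nat -> c k = C0) ->
  Cpartial (fun k => c k * x k)%cx (pred n) = x O.
Proof.
  intros Hn H0 Hc; rewrite (Cpartial_single _ _ O); [rewrite H0; ring|lia|].
  intros k Hk Hk0; rewrite Hc by lia; ring.
Qed.

(** With [u = eta z^n] of modulus 1 the sum is [2 p - u (p + 1) - conj u (p - 1)]. The part free of
    [p] is [conj u - u], purely imaginary, and the rest has real part [2 (1 - Re u) Re p]. *)
Lemma twist_positive (n : nat) (eta : C) (c : nat -> C) : (1 <= n)%nat ->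
  Cnorm eta = 1 -> c O = C1 -> (forall k, (1 <= k < n)%nat -> c k = C0) ->
  abs_summable c -> positive_on_circle c -> positive_on_circle (twist n eta c).
Proof.
  intros Hn He H0 Hc Ha Hp z l Hz Hl.
  assert (Hs : abs_summable (fun k => c k * z ^ k)%cx).
  { apply (abs_summable_le _ (fun k => Cnorm (c k))); [|exact Ha].
    intro k; rewrite Cnorm_mul, Cnorm_pow, Hz, pow1; lra. }
  destruct (abs_summable_conv _ Hs) as [p Hpz].
  pose proof (Hp z p Hz Hpz) as Hp0.
  pose proof (unit_conj_mul z Hz) as Ez.
  assert (El : l = (RtoC 2 * p - eta * (z ^ n * p + z ^ n)
                    - Cconj eta * (Cconj z ^ n * (p - C1)))%cx).
  { apply (Cseries_conv_unique _ _ _ Hl), twist_conv; [exact Hn|exact Hpz| |].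
    - apply (Cseries_conv_ext (fun k => z ^ n * (c k * z ^ k))%cx).
      + intro k; rewrite Cpow_add; ring.
      + apply Cseries_conv_scal; exact Hpz.
    (* On the circle, division by [z^n] is multiplication by [conj z ^ n]. *)
    - pose proof (Cseries_conv_incr _ _ n Hn Hpz) as H.
      rewrite (Cpartial_gap n c (fun k => z ^ k)%cx Hn H0 Hc) in H.
      apply (Cseries_conv_scal (Cconj z ^ n)) in H.
      refine (Cseries_conv_ext _ _ _ _ H); intro k; cbv beta; rewrite Cpow_add.
      replace (Cconj z ^ n * (c (n + k)%nat * (z ^ n * z ^ k)))%cx
        with ((z ^ n * Cconj z ^ n) * (c (n + k)%nat * z ^ k))%cx by ring.
      rewrite <- Cpow_mul, Ez.
      replace (C1 ^ n)%cx with C1; [ring|].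
      clear; induction n as [|n IH]; simpl; [|rewrite <- IH]; ring. }
  assert (Ecz : forall k, (Cconj z ^ k = Cconj (z ^ k))%cx).
  { intro k; induction k as [|k IH]; [cx_eq|].
    simpl; rewrite IH, Cconj_mul; reflexivity. }
  set (u := (eta * z ^ n)%cx).
  assert (Hu : Cnorm u = 1) by (unfold u; rewrite Cnorm_mul, Cnorm_pow, He, Hz, pow1; ring).
  replace l with (RtoC 2 * p - u * (p + C1) - Cconj u * (p - C1))%cx.
  2:{ rewrite El, Ecz; unfold u; rewrite Cconj_mul; ring. }
  replace (Cre _) with (2 * (1 - Cre u) * Cre p) by (simpl; ring).
  pose proof (Cre_le_Cnorm u); apply Rmult_le_pos; lra.
Qed.

(** Sequences of the form affine times geometric are stable under shifts; this is why every piece of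
    the pairing with the twist is again a combination of [P], [D] and constants. *)
Lemma kernel_add (A B r : R) (n k : nat) :
  kernel A B r (n + k) = (RtoC (r ^ n) * kernel (A + B * INR n) B r k)%cx.
Proof. unfold kernel; rewrite pow_add, plus_INR; cx_eq. Qed.

Lemma kernel_conv (c : nat -> C) (A B r : R) (P D : C) :
  Cseries_conv (fun k => c k * RtoC (r ^ k))%cx P ->
  Cseries_conv (fun k => c k * RtoC (INR k * r ^ k))%cx D ->
  Cseries_conv (fun k => c k * kernel A B r k)%cx (RtoC A * P + RtoC B * D).
Proof.
  intros HP HD.
  apply (Cseries_conv_ext (fun k => RtoC A * (c k * RtoC (r ^ k))
    + RtoC B * (c k * RtoC (INR k * r ^ k)))%cx).
  - intro k; unfold kernel; cx_eq.
  - apply Cseries_conv_add; apply Cseries_conv_scal; assumption.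
Qed.

Lemma twist_kernel_inequality (n : nat) (eta : C) (c : nat -> C) (A B r : R) (P D : C) :
  (1 <= n)%nat -> 0 < r < 1 -> 0 <= B -> 2 * r * B <= A * (1 - r * r) ->
  Cnorm eta = 1 -> c O = C1 -> (forall k, (1 <= k < n)%nat -> c k = C0) ->
  abs_summable c -> positive_on_circle c ->
  Cseries_conv (fun k => c k * RtoC (r ^ k))%cx P ->
  Cseries_conv (fun k => c k * RtoC (INR k * r ^ k))%cx D ->
  0 <= Cre (RtoC 2 * (RtoC A * P + RtoC B * D)
    - eta * (RtoC (r ^ n) * (RtoC (A + B * INR n) * (P + C1) + RtoC B * D))
    - Cconj eta * (RtoC (/ r ^ n) * (RtoC (A - B * INR n) * (P - C1) + RtoC B * D))).
Proof.
  intros Hn Hr HB HAB He H0 Hc Ha Hp HP HD.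
  assert (Hs : 0 < r ^ n) by (apply pow_lt; lra).
  assert (HX : Cseries_conv (fun k => twist n eta c k * kernel A B r k)%cx
    (RtoC 2 * (RtoC A * P + RtoC B * D)
     - eta * (RtoC (r ^ n) * (RtoC (A + B * INR n) * P + RtoC B * D) + kernel A B r n)
     - Cconj eta * (RtoC (/ r ^ n) * (RtoC (A - B * INR n) * P + RtoC B * D
         - kernel (A - B * INR n) B r 0)))%cx).
  { apply twist_conv; [exact Hn|apply kernel_conv; assumption| |].
    - apply (Cseries_conv_ext (fun k => RtoC (r ^ n) *
        (c k * kernel (A + B * INR n) B r k))%cx).
      + intro k; rewrite kernel_add; ring.
      + apply Cseries_conv_scal, kernel_conv; assumption.
    (* Shifting the kernel with parameter [A - B n] by [n] gives [r^n] times the original kernel, so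
       the wanted series is a tail of the one for [A - B n], divided by [r^n]. *)
    - pose proof (Cseries_conv_incr _ _ n Hn (kernel_conv c (A - B * INR n) B r P D HP HD)) as H.
      rewrite (Cpartial_gap n c _ Hn H0 Hc) in H.
      apply (Cseries_conv_scal (RtoC (/ r ^ n))) in H.
      refine (Cseries_conv_ext _ _ _ _ H); intro k; cbv beta; rewrite kernel_add.
      replace (A - B * INR n + B * INR n) with A by ring.
      replace (RtoC (/ r ^ n) * (c (n + k)%nat * (RtoC (r ^ n) * kernel A B r k)))%cx
        with ((RtoC (/ r ^ n) * RtoC (r ^ n)) * (c (n + k)%nat * kernel A B r k))%cx by ring.
      rewrite <- RtoC_mul, Rinv_l by lra; change (RtoC 1) with C1; ring. }
  set (X := (_ - _ - _)%cx) in HX.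
  set (e := twist n eta c) in *.
  assert (HY : Cseries_conv (fun k => e k * half_kernel A B r k)%cx
    (X + e O * RtoC (- (A / 2)))).
  { apply (Cseries_conv_ext (fun k => e k * kernel A B r k
      + single 0 (e O * RtoC (- (A / 2))) k)%cx).
    - intro k; unfold half_kernel, single; destruct (Nat.eqb_spec k 0) as [->|_]; ring.
    - apply Cseries_conv_add; [exact HX|apply single_conv]. }
  pose proof (Hadamard_positivity e (half_kernel A B r) _
    (twist_summable n eta c Ha) (half_kernel_summable A B r Hr)
    (twist_positive n eta c Hn He H0 Hc Ha Hp) (half_kernel_positive A B r Hr HB HAB) HY) as H.
  (* The corrections [- (A / 2) e_0] from the halving and [(A / 2) conj e_0] from the averaging
     cancel in the real part. *)
  replace (Cre _) with (Cre X) in H.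
  2:{ replace (half_kernel A B r 0) with (RtoC (A / 2))
        by (unfold half_kernel, kernel, single; simpl; cx_eq; field).
      simpl; ring. }
  replace (Cre _) with (Cre X); [exact H|f_equal; unfold X, kernel].
  replace ((A + B * INR n) * r ^ n) with (r ^ n * (A + B * INR n)) by ring.
  replace ((A - B * INR n + B * INR 0) * r ^ 0) with (A - B * INR n) by (simpl; ring).
  rewrite (RtoC_mul (r ^ n)); ring.
Qed.

(** [1 - r^(2n)] is [1 - r^2] times the sum of [r^(2k)] over [k < n], and each of these [n] terms is
    at least [r^(2n)]. *)
Lemma index_pow_bound (n : nat) (r : R) : 0 < r < 1 ->
  INR n * (r ^ n * r ^ n) * (1 - r * r) <= 1 - r ^ n * r ^ n.
Proof.
  intro Hr; induction n as [|n IH]; [simpl; lra|].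
  rewrite S_INR; simpl pow; pose proof (pow_lt r n (proj1 Hr)).
  assert (r ^ n <= 1) by (rewrite <- (pow1 n); apply pow_incr; lra).
  set (s := r ^ n) in *; set (x := INR n) in *; clearbody s x.
  assert (H1 : r * r * (x * (s * s) * (1 - r * r)) <= r * r * (1 - s * s))
    by (apply Rmult_le_compat_l; nra).
  assert (0 <= (1 - r * r) * (1 - s * s * (r * r))).
  { assert (r * r <= 1) by nra; assert (s * s <= 1) by nra.
    assert (s * s * (r * r) <= 1 * 1) by (apply Rmult_le_compat; nra).
    apply Rmult_le_pos; lra. }
  lra.
Qed.

(** This is the hypothesis of [half_kernel_positive] for the chosen [A] and [B], multiplied by [n].
    With [r = exp (- t)] it reads [tanh (n t) <= n sinh t]. *)
Lemma kernel_condition (n : nat) (r : R) : 0 < r < 1 ->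
  2 * r * (1 - r ^ n * r ^ n) <= INR n * ((1 + r ^ n * r ^ n) * (1 - r * r)).
Proof.
  intro Hr; induction n as [|n IH]; [simpl; lra|].
  pose proof (index_pow_bound n r Hr) as H1.
  rewrite S_INR; simpl pow; pose proof (pow_lt r n (proj1 Hr)).
  assert (r ^ n <= 1) by (rewrite <- (pow1 n); apply pow_incr; lra).
  set (s := r ^ n) in *; set (x := INR n) in *; clearbody s x.
  (* From [n] to [n + 1] the right side minus the left grows by [1 - r^2] times this quantity, which
     [index_pow_bound] bounds below by the square of [s (1 - r)]. *)
  assert (0 <= 1 - s * s * (x * (1 - r * r) + 2 * r - r * r))
    by (pose proof (Rle_0_sqr (s * (1 - r))) as Q; unfold Rsqr in Q; lra).
  assert (0 <= (1 - r * r) * (1 - s * s * (x * (1 - r * r) + 2 * r - r * r)))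
    by (apply Rmult_le_pos; nra).
  lra.
Qed.

(** The map [eta -> (eta - s) / (1 - eta s)] permutes the unit circle, and the witness is its
    inverse at [d]. For [d = D / |D|], the identity [conj eta (eta - s) = conj (1 - eta s)] then
    turns [conj eta (1 - eta s)^2 D] into [|1 - eta s|^2 |D|]. *)
Lemma Blaschke_onto (d : C) (s : R) : Cnorm d = 1 -> 0 < s < 1 ->
  exists eta, Cnorm eta = 1 /\ (d * (C1 - eta * RtoC s) = eta - RtoC s)%cx.
Proof.
  intros Hd Hs.
  assert (Hw : (C1 + d * RtoC s)%cx <> C0).
  { replace (C1 + d * RtoC s)%cx with (C1 - (- d) * RtoC s)%cx by ring.
    apply one_sub_neq0; rewrite Cnorm_mul, Cnorm_opp, Hd, Cnorm_RtoC, Rabs_pos_eq; lra. }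
  exists ((d + RtoC s) / (C1 + d * RtoC s))%cx; split.
  - rewrite Cnorm_div by exact Hw.
    replace (Cnorm (d + RtoC s)) with (Cnorm (C1 + d * RtoC s)).
    + apply Rinv_r; pose proof (Cnorm_pos _ Hw); lra.
    + pose proof (Cnorm_sqr d) as E; rewrite Hd in E.
      unfold Cnorm at 1 2; f_equal; unfold Cnorm2 in *; simpl in *.
      nra.
  - field; exact Hw.
Qed.

(** [P] and [D] are [p] and [z p'] at the real point [r]; a general point is reached by absorbing a
    factor [y^k] into [c k]. *)
Lemma derivative_bound (n : nat) (c : nat -> C) (r : R) (P D : C) :
  (1 <= n)%nat -> 0 < r < 1 ->
  c O = C1 -> (forall k, (1 <= k < n)%nat -> c k = C0) ->
  abs_summable c -> positive_on_circle c ->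
  Cseries_conv (fun k => c k * RtoC (r ^ k))%cx P ->
  Cseries_conv (fun k => c k * RtoC (INR k * r ^ k))%cx D ->
  0 <= Cre P ->
  (1 - r ^ n * r ^ n) * Cnorm D <= 2 * (INR n * r ^ n) * Cre P.
Proof.
  intros Hn Hr H0 Hc Ha Hp HP HD HreP.
  set (s := r ^ n).
  assert (Hs : 0 < s < 1).
  { split; [apply pow_lt; lra|apply pow_lt_1_compat; lra || lia]. }
  assert (HnR : 1 <= INR n) by (change 1 with (INR 1); apply le_INR; exact Hn).
  destruct (Ceq_dec D C0) as [->|HD0].
  { rewrite Cnorm_C0; assert (0 <= INR n * s) by nra; nra. }
  pose proof (Cnorm_pos D HD0) as HDpos.
  destruct (Blaschke_onto (D / RtoC (Cnorm D)) s) as [eta [He Heta]]; [|exact Hs|].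
  { rewrite Cnorm_div, Cnorm_RtoC, Rabs_pos_eq by
      (try apply RtoC_neq0; pose proof (Cnorm_ge0 D); lra).
    apply Rinv_r; lra. }
  set (A := 1 + s * s); set (B := (1 - s * s) / INR n).
  assert (HB : 0 <= B) by (apply Rdiv_le_0_compat; nra).
  assert (HAB : 2 * r * B <= A * (1 - r * r)).
  { apply Rmult_le_reg_r with (INR n); [lra|].
    pose proof (kernel_condition n r Hr) as K; fold s in K; fold A in K.
    replace (2 * r * B * INR n) with (2 * r * (1 - s * s)) by (unfold B; field; lra).
    lra. }
  pose proof (twist_kernel_inequality n eta c A B r P D Hn Hr HB HAB He H0 Hc Ha Hp HP HD) as H.
  fold s in H.
  (* [A] and [B] solve [A + B n = 2] and [A - B n = 2 s^2]: both shifted copies of [P] then carry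
     the same factor [2 s], and the coefficients of [P] add up to [2 (1 + s^2 - 2 s Re eta) = 2 |1 -
     eta s|^2]. *)
  replace (A + B * INR n) with 2 in H by (unfold A, B; field; lra).
  replace (A - B * INR n) with (2 * (s * s)) in H by (unfold A, B; field; lra).
  set (w := (C1 - eta * RtoC s)%cx) in *.
  assert (Hw : w <> C0).
  { apply one_sub_neq0; rewrite Cnorm_mul, He, Cnorm_RtoC, Rabs_pos_eq; lra. }
  pose proof (unit_conj_mul eta He) as Ee.
  assert (Hm : 0 < Cnorm2 w) by
    (pose proof (Cnorm2_ge0 w); pose proof (Cnorm2_neq0 w Hw); lra).
  assert (Hs0 : RtoC s <> C0) by (apply RtoC_neq0; lra).
  assert (EX : Cre (RtoC 2 * (RtoC A * P + RtoC B * D)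
      - eta * (RtoC s * (RtoC 2 * (P + C1) + RtoC B * D))
      - Cconj eta * (RtoC (/ s) * (RtoC (2 * (s * s)) * (P - C1) + RtoC B * D)))
    = Cnorm2 w * (2 * Cre P - B * / s * Cnorm D)).
  { assert (EK : (Cconj eta * w * w * D = RtoC (Cnorm2 w * Cnorm D))%cx).
    { rewrite RtoC_mul, <- Cmul_conj.
      replace (Cconj eta * w * w * D)%cx
        with (Cconj eta * (D / RtoC (Cnorm D) * w) * w * RtoC (Cnorm D))%cx
        by (field; apply RtoC_neq0; lra).
      rewrite Heta.
      replace (Cconj w) with (C1 - Cconj eta * RtoC s)%cx by (unfold w; cx_eq).
      replace (Cconj eta * (eta - RtoC s))%cx
        with (eta * Cconj eta - Cconj eta * RtoC s)%cx by ring.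
      rewrite Ee; ring. }
    transitivity (Cre (RtoC (2 * Cnorm2 w) * P - RtoC (B * / s) * (Cconj eta * w * w * D))).
    2:{ rewrite EK; simpl; ring. }
    (* The remainder [2 s (conj eta - eta)] stems from the constants in [P + 1] and [P - 1]; it is
       purely imaginary. *)
    replace (_ - _ - _)%cx with
      (RtoC (2 * Cnorm2 w) * P - RtoC (B * / s) * (Cconj eta * w * w * D)
       + RtoC (2 * s) * (Cconj eta - eta))%cx.
    - change (Cre (?a + ?b)%cx) with (Cre a + Cre b); rewrite Cre_RtoC_mul; simpl; ring.
    - rewrite !RtoC_mul, <- Cmul_conj.
      replace (Cconj w) with (C1 - Cconj eta * RtoC s)%cx by (unfold w; cx_eq).
      unfold A; rewrite RtoC_add, RtoC_mul; change (RtoC 1) with C1.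
      assert (Ei : RtoC (/ s) = Cinv (RtoC s)).
      { replace (RtoC (/ s)) with (RtoC (/ s) * RtoC s * Cinv (RtoC s))%cx
          by (field; exact Hs0).
        rewrite <- RtoC_mul, Rinv_l by lra; change (RtoC 1) with C1; ring. }
      rewrite Ei; unfold w.
      assert (E0 : eta <> C0) by (apply Cnorm_neq0; lra).
      replace (Cconj eta) with (Cinv eta).
      + change (RtoC 2) with (RtoC (1 + 1)); rewrite RtoC_add; change (RtoC 1) with C1.
        field; split; assumption.
      + replace (Cinv eta) with (Cinv eta * C1)%cx by ring.
        rewrite <- Ee; field; exact E0. }
  rewrite EX in H.
  assert (H2 : 0 <= 2 * Cre P - B * / s * Cnorm D).
  { apply Rmult_le_reg_l with (Cnorm2 w); [exact Hm|lra]. }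
  apply Rmult_le_reg_l with (/ (INR n * s)); [apply Rinv_0_lt_compat; nra|].
  replace (/ (INR n * s) * (2 * (INR n * s) * Cre P)) with (2 * Cre P) by (field; lra).
  replace (/ (INR n * s) * ((1 - s * s) * Cnorm D)) with (B * / s * Cnorm D)
    by (unfold B; field; lra).
  lra.
Qed.

(** * Differentiation of power series *)

(** The remainder [(z + h)^k - z^k - k z^(k-1) h], defined by recursion so that no exponent [k - 1]
    occurs. *)
Fixpoint taylor_rest (z h : C) (k : nat) : C :=
  match k with
  | O => C0
  | S k' => (z * taylor_rest z h k' + h * ((z + h) ^ k' - z ^ k'))%cx
  end.

Lemma taylor_rest_eq (z h : C) (k : nat) : z <> C0 ->
  ((z + h) ^ k = z ^ k + RtoC (INR k) * z ^ k * (h / z) + taylor_rest z h k)%cx.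
Proof.
  intro Hz; induction k as [|k IH].
  - simpl; replace (RtoC 0) with C0 by reflexivity; field; exact Hz.
  - rewrite S_INR, RtoC_add; change (RtoC 1) with C1; simpl Cpow; simpl taylor_rest.
    rewrite IH; field; exact Hz.
Qed.

(** The factor [rho] on the left replaces the exponent [k - 1] on the right. *)
Lemma pow_increment_le (z h : C) (rho : R) (k : nat) : 0 < rho ->
  Cnorm z <= rho -> Cnorm (z + h) <= rho ->
  rho * Cnorm ((z + h) ^ k - z ^ k) <= INR k * Cnorm h * rho ^ k.
Proof.
  intros Hr Hz Hzh; induction k as [|k IH].
  - simpl; replace (C1 - C1)%cx with C0 by ring; rewrite Cnorm_C0; lra.
  - rewrite S_INR; simpl Cpow; simpl pow.
    replace ((z + h) * (z + h) ^ k - z * z ^ k)%cx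
      with ((z + h) * ((z + h) ^ k - z ^ k) + h * z ^ k)%cx by ring.
    eapply Rle_trans; [apply Rmult_le_compat_l; [lra|apply Cnorm_triangle]|].
    rewrite !Cnorm_mul, Cnorm_pow.
    assert (H1 : Cnorm (z + h) * (rho * Cnorm ((z + h) ^ k - z ^ k))
      <= rho * (INR k * Cnorm h * rho ^ k)).
    { apply Rmult_le_compat; try assumption; [apply Cnorm_ge0|].
      apply Rmult_le_pos; [lra|apply Cnorm_ge0]. }
    assert (H2 : Cnorm z ^ k <= rho ^ k) by (apply pow_incr; split; [apply Cnorm_ge0|exact Hz]).
    assert (H3 : rho * Cnorm h * Cnorm z ^ k <= rho * Cnorm h * rho ^ k).
    { apply Rmult_le_compat_l; [pose proof (Cnorm_ge0 h); nra|exact H2]. }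
    lra.
Qed.

Lemma taylor_rest_le (z h : C) (rho : R) (k : nat) : 0 < rho ->
  Cnorm z <= rho -> Cnorm (z + h) <= rho ->
  rho * rho * Cnorm (taylor_rest z h k) <= INR (S k) ^ 2 * (Cnorm h * Cnorm h) * rho ^ k.
Proof.
  intros Hr Hz Hzh.
  (* The induction runs with [INR k ^ 2]; the larger weight of the statement is the one in
     [summable_of_conv_on_disk]. *)
  assert (G : rho * rho * Cnorm (taylor_rest z h k)
    <= INR k ^ 2 * (Cnorm h * Cnorm h) * rho ^ k).
  { induction k as [|k IH].
    - simpl; rewrite Cnorm_C0; lra.
    - rewrite S_INR; simpl taylor_rest; simpl (rho ^ S k).
      pose proof (Cnorm_ge0 h) as Hh; pose proof (pow_lt rho k Hr) as Hp.
      pose proof (pow_increment_le z h rho k Hr Hz Hzh) as H1.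
      pose proof (Cnorm_triangle (z * taylor_rest z h k) (h * ((z + h) ^ k - z ^ k))) as T.
      rewrite !Cnorm_mul in T.
      assert (H2 : Cnorm z * (rho * rho * Cnorm (taylor_rest z h k))
        <= rho * (INR k ^ 2 * (Cnorm h * Cnorm h) * rho ^ k)).
      { apply Rmult_le_compat; try assumption; [apply Cnorm_ge0|].
        apply Rmult_le_pos; [nra|apply Cnorm_ge0]. }
      assert (H3 : rho * Cnorm h * (rho * Cnorm ((z + h) ^ k - z ^ k))
        <= rho * Cnorm h * (INR k * Cnorm h * rho ^ k))
        by (apply Rmult_le_compat_l; [nra|exact H1]).
      apply (Rmult_le_compat_l (rho * rho)) in T; [|nra].
      assert (0 <= rho * ((INR k + 1) * (Cnorm h * Cnorm h) * rho ^ k)).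
      { pose proof (pos_INR k); repeat apply Rmult_le_pos; lra. }
      nra. }
  eapply Rle_trans; [exact G|].
  apply Rmult_le_compat_r; [apply pow_le; lra|].
  apply Rmult_le_compat_r; [pose proof (Cnorm_ge0 h); nra|].
  rewrite S_INR; pose proof (pos_INR k); nra.
Qed.

(** Here [D = z p'(z)], so [D * (h / z)] is the linear term [p'(z) h]. The remainders are summed
    against [|c k|] with a bound quadratic in [h]. *)
Lemma power_series_second_order (c : nat -> C) (p : C -> C) (z D : C) :
  (forall w, in_D w -> Cseries_conv (fun k => c k * w ^ k)%cx (p w)) ->
  in_D z -> z <> C0 -> Cseries_conv (fun k => RtoC (INR k) * (c k * z ^ k))%cx D ->
  exists K delta, 0 <= K /\ 0 < delta /\ forall h, Cnorm h < delta ->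
    in_D (z + h) /\
    Cnorm (p (z + h)%cx - p z - D * (h / z)) <= K * (Cnorm h * Cnorm h).
Proof.
  intros Hp Hz Hz0 HD; unfold in_D, in_disk in Hz.
  pose proof (Cnorm_pos z Hz0) as Hzp.
  (* Halfway between [|z|] and 1: there is room for [z + h], and the weighted series still converges
     at [rho]. *)
  set (rho := (Cnorm z + 1) / 2).
  assert (Hr : 0 < rho < 1) by (unfold rho; lra).
  pose proof (summable_of_conv_on_disk c rho
    (fun w Hw => ex_intro _ _ (Hp w Hw)) (conj (Rlt_le _ _ (proj1 Hr)) (proj2 Hr))) as HS.
  set (S0 := Series (fun k => INR (S k) ^ 2 * (Cnorm (c k) * rho ^ k))).
  assert (Hterm : forall k, 0 <= INR (S k) ^ 2 * (Cnorm (c k) * rho ^ k)).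
  { intro k; apply Rmult_le_pos; [apply pow2_ge_0|].
    apply Rmult_le_pos; [apply Cnorm_ge0|apply pow_le; lra]. }
  assert (HS0 : 0 <= S0).
  { eapply Rle_trans; [|apply (sum_n_le_Series _ O Hterm HS)].
    rewrite sum_O; apply Hterm. }
  exists (S0 / (rho * rho)), (rho - Cnorm z).
  split; [apply Rdiv_le_0_compat; [exact HS0|nra]|].
  split; [unfold rho; lra|].
  intros h Hh.
  assert (Hzh : Cnorm (z + h) <= rho) by (pose proof (Cnorm_triangle z h); lra).
  assert (HzD : in_D (z + h)) by (unfold in_D, in_disk; lra).
  split; [exact HzD|].
  assert (HE : Cseries_conv (fun k => c k * taylor_rest z h k)%cx
    (p (z + h)%cx - p z - D * (h / z))).
  { pose proof (Cseries_conv_add _ _ _ _ (Hp _ HzD)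
      (Cseries_conv_add _ _ _ _ (Cseries_conv_scal (- C1) _ _ (Hp z Hz))
        (Cseries_conv_scal (- (h / z)) _ _ HD))) as H.
    replace (p (z + h)%cx - p z - D * (h / z))%cx
      with (p (z + h)%cx + (- C1 * p z + - (h / z) * D))%cx by ring.
    refine (Cseries_conv_ext _ _ _ _ H); intro k; cbv beta.
    rewrite (taylor_rest_eq z h k Hz0); ring. }
  set (x := Cnorm h * Cnorm h / (rho * rho)).
  assert (Hle : forall k, Cnorm (c k * taylor_rest z h k)
    <= x * (INR (S k) ^ 2 * (Cnorm (c k) * rho ^ k))).
  { intro k; rewrite Cnorm_mul.
    pose proof (taylor_rest_le z h rho k (proj1 Hr) ltac:(unfold rho; lra) Hzh) as T.
    apply Rmult_le_reg_l with (rho * rho); [nra|].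
    replace (rho * rho * (x * (INR (S k) ^ 2 * (Cnorm (c k) * rho ^ k))))
      with (Cnorm (c k) * (INR (S k) ^ 2 * (Cnorm h * Cnorm h) * rho ^ k))
      by (unfold x; field; lra).
    apply (Rmult_le_compat_l (Cnorm (c k))) in T; [lra|apply Cnorm_ge0]. }
  assert (HX : ex_series (fun k => x * (INR (S k) ^ 2 * (Cnorm (c k) * rho ^ k))))
    by exact (ex_series_scal (K := R_AbsRing) (V := R_NormedModule) _ _ HS).
  pose proof (abs_summable_le _ _ Hle HX) as Habs.
  eapply Rle_trans; [apply (Cseries_norm_le _ _ Habs HE)|].
  eapply Rle_trans; [apply (Series_le _ _ (fun k => conj (Cnorm_ge0 _) (Hle k)) HX)|].
  rewrite Series_scal_l; fold S0; right; unfold x; field; lra.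
Qed.

Lemma deriv_mul_series (f p : C -> C) (c : nat -> C) (z D : C) :
  (forall w, in_D w -> Cseries_conv (fun k => c k * w ^ k)%cx (p w)) ->
  (forall w, in_D w -> w <> C0 -> f w = (w * p w)%cx) ->
  in_D z -> z <> C0 -> Cseries_conv (fun k => RtoC (INR k) * (c k * z ^ k))%cx D ->
  C_deriv f z (p z + D).
Proof.
  intros Hp Hf Hz Hz0 HD eps Heps.
  destruct (power_series_second_order c p z D Hp Hz Hz0 HD) as [K [delta [HK [Hd H]]]].
  pose proof (Cnorm_pos z Hz0) as Hzp.
  set (T := K + Cnorm (D / z)).
  assert (HT : 0 <= T) by (pose proof (Cnorm_ge0 (D / z)); unfold T; lra).
  (* Keeping [|h| < |z|] ensures [z + h <> 0], where [f w = w p(w)] is available; the error of the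
     difference quotient is at most [T |h|], whence the third bound. *)
  exists (Rmin delta (Rmin (Cnorm z) (eps / (T + 1)))).
  split; [repeat apply Rmin_pos; try assumption; apply Rdiv_lt_0_compat; lra|].
  intros h Hh0 Hh.
  assert (Hh1 : Cnorm h < delta) by (eapply Rlt_le_trans; [exact Hh|apply Rmin_l]).
  assert (Hh2 : Cnorm h < Cnorm z).
  { eapply Rlt_le_trans; [exact Hh|eapply Rle_trans; [apply Rmin_r|apply Rmin_l]]. }
  assert (Hh3 : Cnorm h < eps / (T + 1)).
  { eapply Rlt_le_trans; [exact Hh|eapply Rle_trans; [apply Rmin_r|apply Rmin_r]]. }
  destruct (H h Hh1) as [HzD HE].
  pose proof (Cnorm_pos h Hh0) as Hhp.
  assert (Hzh0 : (z + h)%cx <> C0).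
  { intro E; assert (h = - z)%cx by (replace h with ((z + h) - z)%cx by ring; rewrite E; ring).
    subst h; rewrite Cnorm_opp in Hh2; lra. }
  rewrite (Hf _ HzD Hzh0), (Hf z Hz Hz0).
  set (E := (p (z + h)%cx - p z - D * (h / z))%cx) in *.
  replace (((z + h) * p (z + h) - z * p z) / h - (p z + D))%cx
    with ((z + h) * (E / h) + h * (D / z))%cx by (unfold E; field; split; assumption).
  eapply Rle_lt_trans; [apply Cnorm_triangle|].
  rewrite !(Cnorm_mul _ (_ / _)%cx), (Cnorm_div E h Hh0).
  assert (Cnorm E / Cnorm h <= K * Cnorm h).
  { apply Rmult_le_reg_r with (Cnorm h); [exact Hhp|].
    unfold Rdiv; rewrite Rmult_assoc, Rinv_l by lra; lra. }
  assert (Cnorm (z + h) * (Cnorm E / Cnorm h) <= 1 * (K * Cnorm h)).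
  { apply Rmult_le_compat; [apply Cnorm_ge0| |unfold in_D, in_disk in HzD; lra|assumption].
    apply Rdiv_le_0_compat; [apply Cnorm_ge0|exact Hhp]. }
  assert (Cnorm h * (T + 1) < eps).
  { apply (Rmult_lt_compat_r (T + 1)) in Hh3; [|lra].
    unfold Rdiv in Hh3; rewrite Rmult_assoc, Rinv_l in Hh3 by lra; lra. }
  unfold T in *; nra.
Qed.

Lemma C_deriv_unique (f : C -> C) (z d d' : C) :
  C_deriv f z d -> C_deriv f z d' -> d = d'.
Proof.
  intros H H'; destruct (Ceq_dec (d - d') C0) as [E|E].
  { replace d with ((d - d') + d')%cx by ring; rewrite E; ring. }
  exfalso; pose proof (Cnorm_pos _ E) as Hpos.
  destruct (H (Cnorm (d - d') / 2)) as [r [Hr H1]]; [lra|].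
  destruct (H' (Cnorm (d - d') / 2)) as [r' [Hr' H2]]; [lra|].
  set (h := RtoC (Rmin r r' / 2)).
  assert (Hm : 0 < Rmin r r') by (apply Rmin_pos; assumption).
  assert (Hh : Cnorm h = Rmin r r' / 2) by (unfold h; rewrite Cnorm_RtoC, Rabs_pos_eq; lra).
  assert (Hh0 : h <> C0) by (apply Cnorm_neq0; lra).
  pose proof (Rmin_l r r'); pose proof (Rmin_r r r').
  specialize (H1 h Hh0 ltac:(lra)); specialize (H2 h Hh0 ltac:(lra)).
  set (q := ((f (z + h)%cx - f z) / h)%cx) in *.
  rewrite Cnorm_sub_sym in H1.
  pose proof (Cnorm_triangle (d - q) (q - d')) as T.
  replace (d - q + (q - d'))%cx with (d - d')%cx in T by ring; lra.
Qed.

Lemma Q_value_unique (f : C -> C) (z q q' : C) : Q_value f z q -> Q_value f z q' -> q = q'.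
Proof.
  intros [_ [d [Hd ->]]] [_ [d' [Hd' ->]]].
  rewrite (C_deriv_unique f z d d' Hd Hd'); reflexivity.
Qed.

Lemma Q_value_mul_series (f p : C -> C) (c : nat -> C) (z D : C) :
  (forall w, in_D w -> Cseries_conv (fun k => c k * w ^ k)%cx (p w)) ->
  (forall w, in_D w -> w <> C0 -> f w = (w * p w)%cx) ->
  in_D z -> z <> C0 -> p z <> C0 ->
  Cseries_conv (fun k => RtoC (INR k) * (c k * z ^ k))%cx D ->
  Q_value f z (C1 + D / p z).
Proof.
  intros Hp Hf Hz Hz0 Hpz HD; split.
  - rewrite (Hf z Hz Hz0); apply Cmul_neq0; assumption.
  - exists (p z + D)%cx; split; [apply (deriv_mul_series f p c); assumption|].
    rewrite (Hf z Hz Hz0); field; split; assumption.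
Qed.

(** * The nephroid domain *)

Fixpoint phi_iter (v : C) (m : nat) : C :=
  match m with O => C0 | S m' => (v + phi_iter v m' ^ 3 / RtoC 3)%cx end.

Lemma RtoC3_neq0 : RtoC 3 <> C0.
Proof. apply RtoC_neq0; lra. Qed.

Lemma Cnorm_cube_third (u : C) : Cnorm (u ^ 3 / RtoC 3) = Cnorm u ^ 3 / 3.
Proof.
  rewrite Cnorm_div by exact RtoC3_neq0.
  rewrite Cnorm_pow, Cnorm_RtoC, Rabs_pos_eq; lra.
Qed.

Lemma cube_third_Lipschitz (u w : C) (rho : R) : Cnorm u <= rho -> Cnorm w <= rho ->
  Cnorm (u ^ 3 / RtoC 3 - w ^ 3 / RtoC 3) <= rho * rho * Cnorm (u - w).
Proof.
  intros Hu Hw; pose proof (Cnorm_ge0 u); pose proof (Cnorm_ge0 w).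
  replace (u ^ 3 / RtoC 3 - w ^ 3 / RtoC 3)%cx
    with ((u * u + u * w + w * w) / RtoC 3 * (u - w))%cx
    by (simpl; field; exact RtoC3_neq0).
  rewrite Cnorm_mul, Cnorm_div by exact RtoC3_neq0.
  apply Rmult_le_compat_r; [apply Cnorm_ge0|].
  rewrite Cnorm_RtoC, Rabs_pos_eq by lra.
  pose proof (Cnorm_triangle (u * u + u * w) (w * w)) as T1.
  pose proof (Cnorm_triangle (u * u) (u * w)) as T2.
  rewrite !Cnorm_mul in *.
  assert (Cnorm u * Cnorm u <= rho * rho) by nra.
  assert (Cnorm u * Cnorm w <= rho * rho) by (apply Rmult_le_compat; lra).
  assert (Cnorm w * Cnorm w <= rho * rho) by nra.
  lra.
Qed.

(* u - u^3/3 = v is solved by iterating the contraction u -> v + u^3/3. *)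
Lemma small_disk_in_Omega (v : C) : Cnorm v < 2 / 3 -> Omega_Ne (C1 + v).
Proof.
  intro Hv; pose proof (Cnorm_ge0 v) as Hv0.
  (* Since [|v| = rho - 1/3], invariance of the disk of radius [rho] amounts to [rho^3 <= 1], and
     the contraction factor is [rho^2 < 1]. *)
  set (rho := 1 / 3 + Cnorm v).
  assert (Hr : 0 < rho < 1) by (unfold rho; lra).
  assert (Hvr : Cnorm v + rho ^ 3 / 3 <= rho).
  { set (d := 1 - rho); assert (0 < d <= 2 / 3) by (unfold d, rho; lra).
    replace (Cnorm v) with (2 / 3 - d) by (unfold d, rho; lra).
    replace rho with (1 - d) by (unfold d; ring); nra. }
  set (x := phi_iter v).
  assert (Hx : forall m, Cnorm (x m) <= rho).
  { intro m; induction m as [|m IH]; [change (x O) with C0; rewrite Cnorm_C0; lra|].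
    change (x (S m)) with (v + x m ^ 3 / RtoC 3)%cx.
    pose proof (Cnorm_triangle v (x m ^ 3 / RtoC 3)) as T.
    rewrite Cnorm_cube_third in T.
    assert (Cnorm (x m) ^ 3 <= rho ^ 3) by (apply pow_incr; split; [apply Cnorm_ge0|exact IH]).
    lra. }
  assert (Hstep : forall m, Cnorm (x (S m) - x m) <= (rho * rho) ^ m).
  { intro m; induction m as [|m IH].
    - simpl pow; replace (x 1%nat - x O)%cx with (x 1%nat) by (change (x O) with C0; ring).
      pose proof (Hx 1%nat); lra.
    - change (x (S (S m))) with (v + x (S m) ^ 3 / RtoC 3)%cx.
      change (x (S m)) with (v + x m ^ 3 / RtoC 3)%cx at 2.
      replace (v + x (S m) ^ 3 / RtoC 3 - (v + x m ^ 3 / RtoC 3))%cx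
        with (x (S m) ^ 3 / RtoC 3 - x m ^ 3 / RtoC 3)%cx by ring.
      eapply Rle_trans; [apply (cube_third_Lipschitz _ _ rho); apply Hx|].
      simpl pow; apply Rmult_le_compat_l; [nra|exact IH]. }
  (* The limit of the iterates is obtained as the sum of a telescoping series. *)
  assert (Ha : abs_summable (fun m => x (S m) - x m)%cx).
  { apply (abs_summable_le _ _ Hstep), ex_series_geom; rewrite Rabs_pos_eq; nra. }
  destruct (abs_summable_conv _ Ha) as [u Hu].
  assert (Hpart : forall m, Cpartial (fun m => x (S m) - x m)%cx m = x (S m)).
  { intro m; induction m as [|m IH].
    { change ((x 1%nat - C0)%cx = x 1%nat); ring. }
    change (Cpartial ?f (S m)) with (Cadd (Cpartial f m) (f (S m))); rewrite IH; ring. }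
  assert (Hur : Cnorm u <= rho).
  { replace u with (u - C0)%cx by ring.
    apply (Cseries_limit_le _ _ _ _ O Hu); intros m _; rewrite Hpart.
    replace (x (S m) - C0)%cx with (x (S m)) by ring; apply Hx. }
  exists u; split; [unfold in_D, in_disk; lra|].
  assert (E : (u - (v + u ^ 3 / RtoC 3))%cx = C0).
  { destruct (Ceq_dec (u - (v + u ^ 3 / RtoC 3)) C0) as [E|E]; [exact E|exfalso].
    pose proof (Cnorm_pos _ E) as Hpos; set (e := Cnorm (u - (v + u ^ 3 / RtoC 3))) in *.
    destruct (Hu (e / 3)) as [N HN]; [lra|].
    pose proof (HN N (le_n N)) as H1; pose proof (HN (S N) ltac:(lia)) as H2.
    rewrite Hpart in H1, H2.
    change (x (S (S N))) with (v + x (S N) ^ 3 / RtoC 3)%cx in H2.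
    pose proof (cube_third_Lipschitz (x (S N)) u rho (Hx _) Hur) as L.
    pose proof (Cnorm_ge0 (x (S N) - u)).
    assert (L' : Cnorm (x (S N) ^ 3 / RtoC 3 - u ^ 3 / RtoC 3) <= Cnorm (x (S N) - u)).
    { assert (rho * rho <= 1) by nra.
      eapply Rle_trans; [exact L|].
      rewrite <- (Rmult_1_l (Cnorm (x (S N) - u))) at 2.
      apply Rmult_le_compat_r; assumption. }
    rewrite Cnorm_sub_sym in H2.
    pose proof (Cnorm_triangle (u - (v + x (S N) ^ 3 / RtoC 3))
      (x (S N) ^ 3 / RtoC 3 - u ^ 3 / RtoC 3)) as T.
    replace (u - (v + x (S N) ^ 3 / RtoC 3) + (x (S N) ^ 3 / RtoC 3 - u ^ 3 / RtoC 3))%cx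
      with (u - (v + u ^ 3 / RtoC 3))%cx in T by ring.
    fold e in T; lra. }
  unfold phi_Ne.
  replace (C1 + v)%cx with (C1 + v + (u - (v + u ^ 3 / RtoC 3)))%cx by (rewrite E; ring).
  ring.
Qed.

Lemma phi_Ne_RtoC (x : R) : phi_Ne (RtoC x) = RtoC (1 + x - x ^ 3 / 3).
Proof.
  unfold phi_Ne; rewrite Cpow_RtoC.
  replace (RtoC (x ^ 3) / RtoC 3)%cx with (RtoC (x ^ 3 / 3)); [cx_eq|].
  replace (RtoC (x ^ 3)) with (RtoC (x ^ 3 / 3) * RtoC 3)%cx
    by (rewrite <- RtoC_mul; f_equal; field).
  field; exact RtoC3_neq0.
Qed.

(** [phi_Ne u = 5/3] means [u^3 - 3 u + 2 = (u - 1)^2 (u + 2) = 0], which has no root in the open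
    disk. In coordinates, the imaginary part forces [u] to be real first. *)
Lemma five_thirds_not_in_Omega : ~ Omega_Ne (RtoC (5 / 3)).
Proof.
  intros [u [Hu E]].
  assert (Hn : Cre u * Cre u + Cim u * Cim u < 1).
  { pose proof (Cnorm_sqr u) as S; unfold Cnorm2 in S; rewrite <- S.
    pose proof (Cnorm_ge0 u); unfold in_D, in_disk in Hu; nra. }
  assert (E3 : (RtoC 3 * (u - RtoC (2 / 3)))%cx = (u * u * u)%cx).
  { replace (RtoC (2 / 3)) with (RtoC (5 / 3) - C1)%cx by (apply C_ext; simpl; field).
    rewrite E; unfold phi_Ne; simpl Cpow; field; exact RtoC3_neq0. }
  destruct u as [a b]; unfold in_D, in_disk in *; simpl in Hn.
  injection E3; simpl; intros Him Hre.
  assert (Hb : b * (3 - 3 * (a * a) + b * b) = 0) by lra.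
  apply Rmult_integral in Hb; destruct Hb as [-> | Hb]; [|nra].
  assert (Ha : (1 - a) * (1 - a) * (2 + a) = 0) by lra.
  assert (-1 < a < 1) by nra.
  apply Rmult_integral in Ha; destruct Ha as [Ha|Ha]; nra.
Qed.

Lemma five_thirds_boundary : bd_Omega_Ne (RtoC (5 / 3)).
Proof.
  intros eps He; split.
  - set (d := Rmin (1 / 2) (eps / 2)).
    assert (Hd : 0 < d) by (apply Rmin_pos; lra).
    assert (d <= 1 / 2) by apply Rmin_l; assert (d <= eps / 2) by apply Rmin_r.
    exists (phi_Ne (RtoC (1 - d))); split.
    + exists (RtoC (1 - d)); split; [|reflexivity].
      unfold in_D, in_disk; rewrite Cnorm_RtoC, Rabs_pos_eq; lra.
    + rewrite phi_Ne_RtoC.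
      replace (RtoC _ - RtoC _)%cx with (RtoC (- (d * d * (3 - d) / 3))) by (cx_eq; field).
      rewrite Cnorm_RtoC, Rabs_Ropp, Rabs_pos_eq by nra; nra.
  - exists (RtoC (5 / 3)); split; [exact five_thirds_not_in_Omega|].
    replace (RtoC (5 / 3) - RtoC (5 / 3))%cx with C0 by ring; rewrite Cnorm_C0; exact He.
Qed.

(** * The radius *)

(** [r0^n] is the positive root of [s^2 + 3 n s = 1], in the rationalized form [2 / (3 n + q)] of
    [(q - 3 n) / 2], where [q^2 = 9 n^2 + 4]. *)
Lemma radius_equation (n : nat) : (1 <= n)%nat ->
  let r0 := Rpower (2 / (3 * INR n + sqrt (9 * INR n ^ 2 + 4))) (1 / INR n) in
  0 < r0 < 1 /\ r0 ^ n * r0 ^ n + 3 * INR n * r0 ^ n = 1.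
Proof.
  intros Hn r0.
  assert (HnR : 1 <= INR n) by (change 1 with (INR 1); apply le_INR; exact Hn).
  set (x := INR n) in *; set (q := sqrt (9 * x ^ 2 + 4)) in *.
  assert (Hq0 : 0 <= q) by apply sqrt_pos.
  assert (Hq : q * q = 9 * x ^ 2 + 4) by (apply sqrt_sqrt; nra).
  assert (H0 : 0 < r0) by apply exp_pos.
  assert (Hs : r0 ^ n = 2 / (3 * x + q)).
  { rewrite <- (Rpower_pow n r0 H0); fold x; unfold r0; rewrite Rpower_mult.
    replace (1 / x * x) with 1 by (field; lra).
    apply Rpower_1, Rdiv_lt_0_compat; lra. }
  assert (E : r0 ^ n * r0 ^ n + 3 * x * r0 ^ n = 1).
  { rewrite Hs.
    replace 1 with ((3 * x + q) * (3 * x + q) / ((3 * x + q) * (3 * x + q))) by (field; lra).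
    replace (2 / (3 * x + q) * (2 / (3 * x + q)) + 3 * x * (2 / (3 * x + q)))
      with ((4 + 6 * x * (3 * x + q)) / ((3 * x + q) * (3 * x + q))) by (field; lra).
    f_equal; lra. }
  split; [split; [exact H0|]|exact E].
  apply Rnot_le_lt; intro H1; pose proof (pow_R1_Rle r0 n H1); nra.
Qed.

Lemma f_over_z_mul (f : C -> C) (w : C) : w <> C0 -> f w = (w * f_over_z f w)%cx.
Proof.
  intro H; unfold f_over_z; destruct (Ceq_dec w C0) as [E|_]; [contradiction|].
  field; exact H.
Qed.

Lemma class_P_log_derivative (n : nat) (c : nat -> C) (p : C -> C) (r0 : R) (z D : C) :
  (1 <= n)%nat -> 0 < r0 < 1 -> r0 ^ n * r0 ^ n + 3 * INR n * r0 ^ n = 1 ->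
  c O = C1 -> (forall k, (1 <= k < n)%nat -> c k = C0) ->
  (forall w, in_D w -> Cseries_conv (fun k => c k * w ^ k)%cx (p w)) ->
  (forall w, in_D w -> 0 < Cre (p w)) ->
  Cnorm z < r0 -> z <> C0 ->
  Cseries_conv (fun k => RtoC (INR k) * (c k * z ^ k))%cx D ->
  Cnorm D < 2 / 3 * Cnorm (p z).
Proof.
  intros Hn Hr0 Hs0 H0 Hc Hp Hpos Hz Hz0 HD.
  pose proof (Cnorm_pos z Hz0) as Hzp.
  assert (HnR : 1 <= INR n) by (change 1 with (INR 1); apply le_INR; exact Hn).
  (* A radius strictly between [|z|] and [r0] serves twice: [|y| < 1] makes the coefficients
     [c k * y ^ k] summable up to the circle, and [r < r0] makes the final inequality strict. *)
  set (r := (Cnorm z + r0) / 2).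
  assert (Hr : 0 < r < r0) by (unfold r; lra).
  assert (Hr' : RtoC r <> C0) by (apply RtoC_neq0; lra).
  assert (HzD : in_D z) by (unfold in_D, in_disk; lra).
  set (y := (z / RtoC r)%cx).
  assert (Hy : Cnorm y < 1).
  { unfold y; rewrite Cnorm_div, Cnorm_RtoC, Rabs_pos_eq by (exact Hr' || lra).
    apply Rmult_lt_reg_r with r; [lra|].
    unfold Rdiv; rewrite Rmult_assoc, Rinv_l by lra; unfold r; lra. }
  assert (Ez : forall k, (y ^ k * RtoC (r ^ k) = z ^ k)%cx).
  { intro k; rewrite <- Cpow_RtoC, <- Cpow_mul; f_equal; unfold y; field; exact Hr'. }
  assert (B : (1 - r ^ n * r ^ n) * Cnorm D <= 2 * (INR n * r ^ n) * Cre (p z)).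
  { apply (derivative_bound n (fun k => c k * y ^ k)%cx r); try assumption; try lra.
    - simpl; rewrite H0; ring.
    - intros k Hk; rewrite (Hc k Hk); ring.
    - pose proof (summable_of_conv_on_disk c (Cnorm y)
        (fun w Hw => ex_intro _ _ (Hp w Hw)) (conj (Cnorm_ge0 y) Hy)) as HS.
      apply (abs_summable_le _ _) with (2 := HS); intro k.
      rewrite Cnorm_mul, Cnorm_pow.
      assert (0 <= Cnorm (c k) * Cnorm y ^ k)
        by (apply Rmult_le_pos; [|apply pow_le]; apply Cnorm_ge0).
      pose proof (INR_S_sqr_ge k); nra.
    - intros w l Hw Hl.
      assert (Hyw : in_D (y * w)) by (unfold in_D, in_disk; rewrite Cnorm_mul, Hw; lra).
      rewrite (Cseries_conv_unique _ l (p (y * w)%cx) Hl);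
        [apply Rlt_le, Hpos; exact Hyw|].
      refine (Cseries_conv_ext _ _ _ _ (Hp _ Hyw)); intro k; rewrite Cpow_mul; ring.
    - apply (Cseries_conv_ext (fun k => c k * z ^ k)%cx); [|apply Hp; exact HzD].
      intro k; rewrite <- Ez; ring.
    - apply (Cseries_conv_ext (fun k => RtoC (INR k) * (c k * z ^ k))%cx); [|exact HD].
      intro k; rewrite <- Ez, RtoC_mul; ring.
    - apply Rlt_le, Hpos; exact HzD. }
  assert (Hs : 0 < r ^ n) by (apply pow_lt; lra).
  assert (Hlt : r ^ n < r0 ^ n).
  { destruct n as [|m]; [lia|]; simpl.
    assert (r ^ m <= r0 ^ m) by (apply pow_incr; lra).
    assert (0 < r ^ m) by (apply pow_lt; lra); nra. }
  pose proof (Cre_le_Cnorm (p z)) as Hle; pose proof (Hpos z HzD) as Hp0.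
  set (s := r ^ n) in *; set (s0 := r0 ^ n) in *; set (x := INR n) in *.
  (* [s^2 + 3 n s] increases with [s] and equals 1 at [s0]. *)
  assert (Hk : 3 * (x * s) < 1 - s * s) by nra.
  assert (Hxs : 0 < x * s) by nra.
  set (t := x * s) in *; clearbody t.
  destruct (Ceq_dec D C0) as [->|HD0]; [rewrite Cnorm_C0; lra|].
  pose proof (Cnorm_pos D HD0) as HDp.
  assert (B1 : 3 * t * Cnorm D < (1 - s * s) * Cnorm D)
    by (apply Rmult_lt_compat_r; assumption).
  assert (B2 : 2 * t * Cre (p z) <= 2 * t * Cnorm (p z))
    by (apply Rmult_le_compat_l; lra).
  apply Rmult_lt_reg_l with (3 * t); lra.
Qed.

Lemma class_W_maps_into_Ne (n : nat) (r0 : R) (f : C -> C) :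
  (1 <= n)%nat -> 0 < r0 < 1 -> r0 ^ n * r0 ^ n + 3 * INR n * r0 ^ n = 1 ->
  class_W n f -> Q_maps_into_Ne f r0.
Proof.
  intros Hn Hr0 Hs0 [_ [[c [H0 [Hc Hp]]] Hpos]] z Hz Hz0; unfold in_disk in Hz.
  set (p := f_over_z f) in *.
  assert (HzD : in_D z) by (unfold in_D, in_disk; lra).
  assert (HS : abs_summable (fun k => RtoC (INR k) * (c k * z ^ k))%cx).
  { pose proof (summable_of_conv_on_disk c (Cnorm z)
      (fun w Hw => ex_intro _ _ (Hp w Hw)) (conj (Cnorm_ge0 z) HzD)) as HS.
    apply (abs_summable_le _ _) with (2 := HS); intro k.
    rewrite !Cnorm_mul, Cnorm_pow, Cnorm_RtoC, Rabs_pos_eq by apply pos_INR.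
    apply Rmult_le_compat_r; [|apply INR_S_sqr_ge].
    apply Rmult_le_pos; [|apply pow_le]; apply Cnorm_ge0. }
  destruct (abs_summable_conv _ HS) as [D HD].
  pose proof (class_P_log_derivative n c p r0 z D Hn Hr0 Hs0 H0 Hc Hp Hpos Hz Hz0 HD) as B.
  pose proof (Cre_le_Cnorm (p z)) as Hle; pose proof (Hpos z HzD) as Hp0.
  assert (Hpz : p z <> C0) by (apply Cnorm_neq0; lra).
  exists (C1 + D / p z)%cx; split.
  - apply (Q_value_mul_series f p c); try assumption.
    intros w _; apply f_over_z_mul.
  - apply small_disk_in_Omega; rewrite Cnorm_div by exact Hpz.
    apply Rmult_lt_reg_r with (Cnorm (p z)); [lra|].
    unfold Rdiv at 1; rewrite Rmult_assoc, Rinv_l by lra; lra.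
Qed.

(** * The extremal function *)

Definition multiples (n k : nat) : C := if Nat.eqb (k mod n) 0 then C1 else C0.

(** From [(1 + w) / (1 - w) = 2 / (1 - w) - 1] with [w = z^n]. *)
Definition extremal_coef (n k : nat) : C :=
  (RtoC 2 * multiples n k + single 0 (- C1) k)%cx.

Definition extremal_quotient (n : nat) (z : C) : C :=
  ((C1 + z ^ n) / (C1 - z ^ n))%cx.

Lemma multiples_add (n k : nat) : (1 <= n)%nat -> multiples n (n + k) = multiples n k.
Proof.
  intro Hn; unfold multiples.
  replace (n + k)%nat with (k + 1 * n)%nat by lia.
  rewrite Nat.Div0.mod_add; reflexivity.
Qed.

Lemma multiples_gap (n k : nat) : (1 <= k < n)%nat -> multiples n k = C0.
Proof.
  intro H; unfold multiples; rewrite Nat.mod_small by lia.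
  destruct k; [lia|reflexivity].
Qed.

Lemma multiples_0 (n : nat) : (1 <= n)%nat -> multiples n 0 = C1.
Proof. intro H; unfold multiples; rewrite Nat.mod_small by lia; reflexivity. Qed.

Lemma Cnorm_multiples (n k : nat) : Cnorm (multiples n k) <= 1.
Proof.
  unfold multiples; destruct (Nat.eqb _ _); [rewrite Cnorm_C1|rewrite Cnorm_C0]; lra.
Qed.

Lemma Cnorm_pow_lt1 (n : nat) (z : C) : (1 <= n)%nat -> in_D z -> Cnorm (z ^ n) < 1.
Proof.
  intros Hn Hz; rewrite Cnorm_pow; apply pow_lt_1_compat; [|lia].
  split; [apply Cnorm_ge0|exact Hz].
Qed.

Lemma multiples_conv (n : nat) (z : C) : (1 <= n)%nat -> in_D z ->
  Cseries_conv (fun k => multiples n k * z ^ k)%cx (C1 / (C1 - z ^ n)).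
Proof.
  intros Hn Hz.
  pose proof (one_sub_neq0 _ (Cnorm_pow_lt1 n z Hn Hz)) as Hd.
  assert (Ha : abs_summable (fun k => multiples n k * z ^ k)%cx).
  { apply (abs_summable_le _ (fun k => Cnorm (z ^ k))); [|exact (pow_summable z Hz)].
    intro k; rewrite Cnorm_mul.
    pose proof (Cnorm_multiples n k); pose proof (Cnorm_ge0 (z ^ k)); nra. }
  destruct (abs_summable_conv _ Ha) as [l Hl].
  rewrite (Cseries_self_shift n (fun k => multiples n k * z ^ k)%cx (fun _ => C0) (z ^ n) C1 l C0 Hn Hd) in Hl;
    try exact Hl; try exact zero_series.
  - replace (C1 / (C1 - z ^ n))%cx with ((C1 + C0) / (C1 - z ^ n))%cx by (field; exact Hd).
    exact Hl.
  - intro k; cbv beta; rewrite multiples_add, Cpow_add by exact Hn; ring.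
  - rewrite (Cpartial_gap n (multiples n) (fun k => z ^ k)%cx Hn (multiples_0 n Hn)
      (fun k => multiples_gap n k)); reflexivity.
Qed.

Lemma index_multiples_conv (n : nat) (z : C) : (1 <= n)%nat -> in_D z ->
  Cseries_conv (fun k => RtoC (INR k) * (multiples n k * z ^ k))%cx
    (RtoC (INR n) * z ^ n / ((C1 - z ^ n) * (C1 - z ^ n))).
Proof.
  intros Hn Hz.
  pose proof (one_sub_neq0 _ (Cnorm_pow_lt1 n z Hn Hz)) as Hd.
  assert (Ha : abs_summable (fun k => RtoC (INR k) * (multiples n k * z ^ k))%cx).
  { apply (abs_summable_le _ (fun k => Cnorm (RtoC (INR k) * z ^ k)));
      [|exact (index_pow_summable z Hz)].
    intro k; rewrite !Cnorm_mul; apply Rmult_le_compat_l; [apply Cnorm_ge0|].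
    pose proof (Cnorm_multiples n k); pose proof (Cnorm_ge0 (z ^ k)); nra. }
  destruct (abs_summable_conv _ Ha) as [l Hl].
  rewrite (Cseries_self_shift n (fun k => RtoC (INR k) * (multiples n k * z ^ k))%cx
    (fun k => RtoC (INR n) * z ^ n * (multiples n k * z ^ k))%cx (z ^ n) C0 l
    (RtoC (INR n) * z ^ n * (C1 / (C1 - z ^ n)))%cx Hn Hd) in Hl; try exact Hl.
  - replace (RtoC (INR n) * z ^ n / ((C1 - z ^ n) * (C1 - z ^ n)))%cx
      with ((C0 + RtoC (INR n) * z ^ n * (C1 / (C1 - z ^ n))) / (C1 - z ^ n))%cx
      by (field; exact Hd).
    exact Hl.
  - intro k; cbv beta; rewrite multiples_add, Cpow_add, plus_INR, RtoC_add by exact Hn; ring.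
  - apply Cpartial_zero; intros k Hk; destruct k as [|k].
    + simpl; change (RtoC 0) with C0; ring.
    + rewrite multiples_gap by lia; ring.
  - apply Cseries_conv_scal, multiples_conv; assumption.
Qed.

Lemma extremal_coef_conv (n : nat) (z : C) : (1 <= n)%nat -> in_D z ->
  Cseries_conv (fun k => extremal_coef n k * z ^ k)%cx (extremal_quotient n z).
Proof.
  intros Hn Hz; pose proof (one_sub_neq0 _ (Cnorm_pow_lt1 n z Hn Hz)) as Hd.
  pose proof (Cseries_conv_add _ _ _ _
    (Cseries_conv_scal (RtoC 2) _ _ (multiples_conv n z Hn Hz)) (single_conv 0 (- C1))) as H.
  replace (extremal_quotient n z) with (RtoC 2 * (C1 / (C1 - z ^ n)) + - C1)%cx.
  - refine (Cseries_conv_ext _ _ _ _ H); intro k; unfold extremal_coef.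
    destruct k as [|k]; [simpl; ring|].
    change (single 0 (- C1) (S k)) with C0; ring.
  - unfold extremal_quotient; change (RtoC 2) with (RtoC (1 + 1)); rewrite RtoC_add.
    change (RtoC 1) with C1; field; exact Hd.
Qed.

Lemma index_extremal_coef_conv (n : nat) (z : C) : (1 <= n)%nat -> in_D z ->
  Cseries_conv (fun k => RtoC (INR k) * (extremal_coef n k * z ^ k))%cx
    (RtoC 2 * (RtoC (INR n) * z ^ n / ((C1 - z ^ n) * (C1 - z ^ n)))).
Proof.
  intros Hn Hz.
  pose proof (Cseries_conv_scal (RtoC 2) _ _ (index_multiples_conv n z Hn Hz)) as H.
  refine (Cseries_conv_ext _ _ _ _ H); intro k; unfold extremal_coef.
  destruct k as [|k]; [simpl; change (RtoC 0) with C0; ring|].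
  change (single 0 (- C1) (S k)) with C0; ring.
Qed.

Lemma extremal_coef_0 (n : nat) : (1 <= n)%nat -> extremal_coef n 0 = C1.
Proof.
  intro Hn; unfold extremal_coef; rewrite multiples_0 by exact Hn; cx_eq.
Qed.

Lemma extremal_coef_gap (n k : nat) : (1 <= k < n)%nat -> extremal_coef n k = C0.
Proof.
  intro H; unfold extremal_coef; rewrite multiples_gap by exact H.
  destruct k as [|k]; [lia|]; change (single 0 (- C1) (S k)) with C0; ring.
Qed.

Lemma f_extremal_mul (n : nat) (z : C) :
  f_extremal n z = (z * extremal_quotient n z)%cx.
Proof. unfold f_extremal, extremal_quotient, Cdiv; ring. Qed.

Lemma f_extremal_over_z (n : nat) (z : C) : (1 <= n)%nat ->
  f_over_z (f_extremal n) z = extremal_quotient n z.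
Proof.
  intro Hn; unfold f_over_z; destruct (Ceq_dec z C0) as [->|Hz].
  - destruct n as [|n]; [lia|]; unfold extremal_quotient; simpl.
    replace (C0 * C0 ^ n)%cx with C0 by ring; field.
    intro E; injection E; lra.
  - rewrite f_extremal_mul; field; exact Hz.
Qed.

Lemma extremal_quotient_pos (n : nat) (z : C) : (1 <= n)%nat -> in_D z ->
  0 < Cre (extremal_quotient n z).
Proof.
  intros Hn Hz; pose proof (Cnorm_pow_lt1 n z Hn Hz) as Hw; unfold extremal_quotient.
  set (w := (z ^ n)%cx) in *; clearbody w.
  pose proof (Cnorm2_neq0 _ (one_sub_neq0 w Hw)) as HN.
  pose proof (Cnorm2_ge0 (C1 - w)) as HN0.
  assert (Hn2 : Cnorm2 w < 1) by (rewrite <- Cnorm_sqr; pose proof (Cnorm_ge0 w); nra).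
  replace (Cre ((C1 + w) / (C1 - w))) with ((1 - Cnorm2 w) / Cnorm2 (C1 - w)).
  - apply Rdiv_lt_0_compat; lra.
  - unfold Cnorm2 in *; simpl in *; unfold Cnorm2 in *; simpl in *; field; lra.
Qed.

Lemma f_extremal_class_W (n : nat) : (1 <= n)%nat -> class_W n (f_extremal n).
Proof.
  intro Hn; split; [|split].
  - exists (fun k => match k with O => C0 | S k => extremal_coef n k end).
    split; [reflexivity|split; [apply extremal_coef_0; exact Hn|split]].
    + intros k Hk; destruct k as [|k]; [lia|apply extremal_coef_gap; lia].
    + intros z Hz; rewrite f_extremal_mul.
      set (u := fun k : nat =>
        (match k with O => C0 | S k => extremal_coef n k end * z ^ k)%cx).
      replace (z * extremal_quotient n z)%cx
        with (z * extremal_quotient n z + Cpartial u (pred 1))%cx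
        by (unfold u; simpl; ring).
      apply (Cseries_conv_decr _ _ 1); [lia|].
      refine (Cseries_conv_ext _ _ _ _
        (Cseries_conv_scal z _ _ (extremal_coef_conv n z Hn Hz))).
      intro k; unfold u; simpl; ring.
  - exists (extremal_coef n); split; [apply extremal_coef_0; exact Hn|split].
    + intros k Hk; apply extremal_coef_gap; exact Hk.
    + intros z Hz; rewrite f_extremal_over_z by exact Hn.
      apply extremal_coef_conv; assumption.
  - intros z Hz; rewrite f_extremal_over_z by exact Hn.
    apply extremal_quotient_pos; assumption.
Qed.

(** At [z = r0], with [s = r0^n], the quotient is [1 + 2 n s / (1 - s^2)], and [1 - s^2 = 3 n s]. *)
Lemma f_extremal_Q_value (n : nat) (r0 : R) :
  (1 <= n)%nat -> 0 < r0 < 1 -> r0 ^ n * r0 ^ n + 3 * INR n * r0 ^ n = 1 ->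
  Q_value (f_extremal n) (RtoC r0) (RtoC (5 / 3)).
Proof.
  intros Hn Hr0 Hs0.
  assert (Hz : in_D (RtoC r0)) by (unfold in_D, in_disk; rewrite Cnorm_RtoC, Rabs_pos_eq; lra).
  assert (Hz0 : RtoC r0 <> C0) by (apply RtoC_neq0; lra).
  assert (Hs : 0 < r0 ^ n) by (apply pow_lt; lra).
  pose proof (extremal_quotient_pos n _ Hn Hz) as Hq.
  assert (Hq0 : extremal_quotient n (RtoC r0) <> C0)
    by (intro E; rewrite E in Hq; simpl in Hq; lra).
  pose proof (one_sub_neq0 _ (Cnorm_pow_lt1 n _ Hn Hz)) as Hd.
  pose proof (Q_value_mul_series (f_extremal n) (extremal_quotient n) (extremal_coef n)
    (RtoC r0) _ (fun w Hw => extremal_coef_conv n w Hn Hw)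
    (fun w _ _ => f_extremal_mul n w) Hz Hz0 Hq0 (index_extremal_coef_conv n _ Hn Hz)) as H.
  replace (RtoC (5 / 3)) with (C1 + RtoC 2 * (RtoC (INR n) * RtoC r0 ^ n
    / ((C1 - RtoC r0 ^ n) * (C1 - RtoC r0 ^ n))) / extremal_quotient n (RtoC r0))%cx;
    [exact H|].
  unfold extremal_quotient; rewrite Cpow_RtoC in *.
  set (s := r0 ^ n) in *; set (x := INR n) in *.
  assert (Hp : (C1 + RtoC s)%cx <> C0) by (intro E; apply (f_equal Cre) in E; simpl in E; lra).
  replace (RtoC (5 / 3)) with (C1 + RtoC (2 * (x * s)) / RtoC (3 * (x * s)))%cx.
  - replace (RtoC (3 * (x * s))) with ((C1 + RtoC s) * (C1 - RtoC s))%cx.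
    + rewrite !RtoC_mul; field; split; assumption.
    + replace (3 * (x * s)) with (1 - s * s) by lra; cx_eq.
  - assert (0 < x) by (apply lt_0_INR; lia).
    assert (0 < x * s) by (apply Rmult_lt_0_compat; assumption).
    assert (Hxs : RtoC (3 * (x * s)) <> C0) by (apply RtoC_neq0; lra).
    replace (RtoC (5 / 3)) with (C1 + RtoC (2 / 3))%cx by (cx_eq; field).
    replace (RtoC (2 * (x * s))) with (RtoC (2 / 3) * RtoC (3 * (x * s)))%cx
      by (rewrite <- RtoC_mul; f_equal; field).
    field; exact Hxs.
Qed.

Theorem mainTheorem11 (n : nat) (hn : (1 <= n)%nat) :
  let r0 := Rpower (2 / (3 * INR n + sqrt (9 * INR n ^ 2 + 4))) (1 / INR n) in
  is_radius_Ne (class_W n) r0 /\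
  class_W n (f_extremal n) /\
  exists z q, Cnorm z = r0 /\ Q_value (f_extremal n) z q /\ bd_Omega_Ne q.
Proof.
  intro r0; destruct (radius_equation n hn) as [Hr0 Hs0]; fold r0 in Hr0, Hs0.
  assert (Hnorm : Cnorm (RtoC r0) = r0) by (rewrite Cnorm_RtoC, Rabs_pos_eq; lra).
  pose proof (f_extremal_Q_value n r0 hn Hr0 Hs0) as HQ.
  split; [split; [split|]|split].
  - lra.
  - intros f Hf; exact (class_W_maps_into_Ne n r0 f hn Hr0 Hs0 Hf).
  (* A larger [rho] would put the point [r0] inside the disk, where the extremal function takes the
     excluded value 5/3. As [Q_value] is a relation, uniqueness of the derivative identifies the
     value supplied by [Hrho] with this one. *)
  - intros rho [_ Hrho]; apply Rnot_lt_le; intro Hlt.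
    destruct (Hrho _ (f_extremal_class_W n hn) (RtoC r0)) as [q [Hq Hom]].
    + unfold in_disk; lra.
    + apply RtoC_neq0; lra.
    + rewrite (Q_value_unique _ _ _ _ Hq HQ) in Hom.
      exact (five_thirds_not_in_Omega Hom).
  - exact (f_extremal_class_W n hn).
  - exists (RtoC r0), (RtoC (5 / 3)).
    split; [exact Hnorm|split; [exact HQ|exact five_thirds_boundary]].
Qed.
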